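(* Let $n\ge1$ and $0<\alpha<1$. The Hermite-Riesz transforms $\mathcal{R}_i$ and $\mathcal{R}_{ij}$, $1\leq|i|,|j|\leq n$, are bounded operators on $C^{0,\alpha}_H$: if $u\in C^{0,\alpha}_H$, then $\mathcal{R}_iu,\mathcal{R}_{ij}u\in C^{0,\alpha}_H$ and $$\|\mathcal{R}_iu\|_{C^{0,\alpha}_H}+\|\mathcal{R}_{ij}u\|_{C^{0,\alpha}_H}\leq C\|u\|_{C^{0,\alpha}_H},$$ with $C$ independent of $u$.
   Context: $H=-\Delta+|x|^2$ on $\mathbb{R}^n$. $A_i=\partial_{x_i}+x_i$ and $A_{-i}=-\partial_{x_i}+x_i$ for $i=1,\dots,n$; indices $i,j$ are nonzero integers with absolute value between $1$ and $n$. For $0<\sigma\le1$, $H^{-\sigma}u(x)=\frac{1}{\Gamma(\sigma)}\int_0^\infty e^{-tH}u(x)\,\frac{dt}{t^{1-\sigma}}$, where $e^{-tH}u(x)=\int_{\mathbb{R}^n}G_t(x,z)u(z)\,dz$, $G_t(x,z)=(2\pi\sinh2t)^{-n/2}e^{-[\frac12|x-z|^2\coth2t+x\cdot z\tanh t]}$. The first and second order Hermite-Riesz transforms are $\mathcal{R}_i=A_iH^{-1/2}$ and $\mathcal{R}_{ij}=A_iA_jH^{-1}$, where for $u\in C_H^{0,\alpha}$ the operators $A_i$ are applied in the sense of tempered distributions; $\mathcal{R}_iu\in C_H^{0,\alpha}$ means that the distribution coincides with a function in that space. For $0<\alpha\le1$, $C_H^{0,\alpha}$ is the set of continuous $u:\mathbb{R}^n\to\mathbb{R}$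 with $\|u\|_{C_H^{0,\alpha}}=[u]_{C^{0,\alpha}}+[u]_{M^\alpha}<\infty$, where $[u]_{C^{0,\alpha}}=\sup_{x_1\ne x_2}\frac{|u(x_1)-u(x_2)|}{|x_1-x_2|^\alpha}$ and $[u]_{M^\alpha}=\sup_x(1+|x|)^\alpha|u(x)|$. *)

(* Defs.v *)
From HB Require Import structures.
From mathcomp Require Import all_boot all_order all_algebra.
From mathcomp Require Import all_classical all_reals all_analysis.

Set Implicit Arguments.
Unset Strict Implicit.
Unset Printing Implicit Defensive.

Import Order.TTheory GRing.Theory Num.Theory.
Import numFieldNormedType.Exports.

Local Open Scope classical_set_scope.
Local Open Scope ring_scope.

(* The library has Lebesgue measure on R and binary products only, so Lebesgue
   measure on R^n is built here on n-tuples with the product sigma-algebra. *)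

Section lebesgue_cons.
Context (R : realType) (n : nat).
Local Notation mR := (measurableTypeR R).
Variable mu : {sigma_finite_measure set (n.-tuple mR) -> \bar R}.

Definition tcons (p : mR * n.-tuple mR) : n.+1.-tuple mR :=
  [tuple of p.1 :: p.2].

Lemma measurable_tcons : measurable_fun setT tcons.
Proof. exact: measurable_cons. Qed.

HB.instance Definition _ := isMeasurableFun.Build _ _ _ _ tcons
  measurable_tcons.

Definition lebesgue_cons : set (n.+1.-tuple mR) -> \bar R :=
  pushforward (@lebesgue_measure R \x mu)%E tcons.

Let lebesgue_cons0 : lebesgue_cons set0 = 0%E.
Proof. exact: measure0. Qed.

Let lebesgue_cons_ge0 A : (0 <= lebesgue_cons A)%E.
Proof. exact: measure_ge0. Qed.

Let lebesgue_cons_sigma_additive : semi_sigma_additive lebesgue_cons.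
Proof. exact: (@measure_semi_sigma_additive). Qed.

HB.instance Definition _ := isMeasure.Build _ _ _ lebesgue_cons
  lebesgue_cons0 lebesgue_cons_ge0 lebesgue_cons_sigma_additive.

Let lebesgue_cons_sigma_finite : sigma_finite setT lebesgue_cons.
Proof.
have /sigma_finiteP[F [TF ndF Foo]] := sigma_finiteT (@lebesgue_measure R).
have /sigma_finiteP[G [TG ndG Goo]] := sigma_finiteT mu.
pose uncons (t : n.+1.-tuple mR) : mR * n.-tuple mR :=
  (thead t, [tuple of behead t]).
have munc : measurable_fun setT uncons.
  apply/measurable_fun_pairP; split.
    exact: measurable_tnth.
  exact: measurable_behead.
have tconsK p : uncons (tcons p) = p.
  case: p => x t; rewrite /uncons /tcons /thead (tnth_nth x)/=; congr pair.
  exact: val_inj.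
exists (fun k => uncons @^-1` (F k `*` G k)).
  rewrite -preimage_bigcup [X in _ @^-1` X](_ : _ = setT) ?preimage_setT//.
  rewrite -setXTT TF TG predeqE => -[x y]; split.
    by move=> [k _ []/= ? ?]; split; exists k.
  move=> [/= [i _ Fix] [k _ Gky]]; exists (maxn i k) => //; split.
  - by move: x Fix; exact/subsetPset/ndF/leq_maxl.
  - by move: y Gky; exact/subsetPset/ndG/leq_maxr.
move=> k; have [mF Fk] := Foo k; have [mG Gk] := Goo k; split.
  by rewrite -[X in measurable X]setTI; apply: munc => //; exact: measurableX.
rewrite /lebesgue_cons /pushforward -comp_preimage.
rewrite (_ : uncons \o tcons = id) ?preimage_id; last exact/funext.
by rewrite product_measure1E// lte_mul_pinfty// ge0_fin_numE.
Qed.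

HB.instance Definition _ := Measure_isSigmaFinite.Build _ _ _ lebesgue_cons
  lebesgue_cons_sigma_finite.

End lebesgue_cons.

Fixpoint lebesgue_tuple (R : realType) (n : nat) :
    {sigma_finite_measure set (n.-tuple (measurableTypeR R)) -> \bar R} :=
  match n with
  | 0 => [the {sigma_finite_measure set _ -> \bar R} of
           \d_([tuple] : 0.-tuple (measurableTypeR R))]
  | m.+1 => [the {sigma_finite_measure set _ -> \bar R} of
              lebesgue_cons (lebesgue_tuple R m)]
  end.

(* Points of R^n are row vectors, the normed spaces on which the library has
   differential calculus; its norm there is the sup norm, hence [enorm]. *)
Definition tuple_rV (R : realType) (n : nat)
  (t : n.-tuple (measurableTypeR R)) : 'rV[R]_n := \row_k tnth t k.

Definition integral_rV (R : realType) (n : nat) (f : 'rV[R]_n -> R) : R :=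
  \int[lebesgue_tuple R n]_t f (tuple_rV t).

Section hermite.
Context (R : realType) (n : nat).
Implicit Types (x y z : 'rV[R]_n) (u f g phi : 'rV[R]_n -> R).

Definition dotp x y : R := \sum_k x 0 k * y 0 k.
Definition enorm x : R := Num.sqrt (dotp x x).

Definition holder_seminorm (alpha : R) u : \bar R :=
  ereal_sup [set r | exists x1 x2, x1 != x2 /\
    r = (`|u x1 - u x2| / enorm (x1 - x2) `^ alpha)%:E].

Definition growth_seminorm (alpha : R) u : \bar R :=
  ereal_sup [set ((1 + enorm x) `^ alpha * `|u x|)%:E | x in [set: 'rV[R]_n]].

Definition CH_norm (alpha : R) u : \bar R :=
  (holder_seminorm alpha u + growth_seminorm alpha u)%E.

Definition CH (alpha : R) : set ('rV[R]_n -> R) :=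
  [set u | continuous u /\ (CH_norm alpha u < +oo)%E].

Definition sinh (t : R) : R := (expR t - expR (- t)) / 2.
Definition cosh (t : R) : R := (expR t + expR (- t)) / 2.
Definition tanh (t : R) : R := sinh t / cosh t.
Definition coth (t : R) : R := cosh t / sinh t.

Definition Gamma (s : R) : R :=
  \int[@lebesgue_measure R]_(t in `]0, +oo[) (t `^ (s - 1) * expR (- t)).

Definition mehler_kernel (t : R) x z : R :=
  (2 * pi * sinh (2 * t)) `^ (- (n%:R / 2)) *
  expR (- (2^-1 * enorm (x - z) ^+ 2 * coth (2 * t) + dotp x z * tanh t)).

Definition heat_semigroup (t : R) u x : R :=
  integral_rV (fun z => mehler_kernel t x z * u z).

Definition H_negpow (sigma : R) u x : R :=
  (Gamma sigma)^-1 *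
  \int[@lebesgue_measure R]_(t in `]0, +oo[)
    (heat_semigroup t u x / t `^ (1 - sigma)).

Definition partial (k : 'I_n) f : 'rV[R]_n -> R :=
  fun x => 'D_(delta_mx 0 k) f x.

Definition iter_partial (s : seq 'I_n) f : 'rV[R]_n -> R :=
  foldr partial f s.

(* Differentiability of every iterated partial derivative amounts to being
   C^infinity. *)
Definition schwartz phi : Prop :=
  (forall s x, differentiable (iter_partial s phi) x) /\
  (forall s (N : nat), exists M : R, forall x,
     (1 + enorm x) ^+ N * `|iter_partial s phi x| <= M).

(* Distributions are represented by their action on Schwartz functions; the
   values at other functions are irrelevant. *)
Definition distr := ('rV[R]_n -> R) -> R.
Implicit Types T : distr.

Definition distr_of_fun f : distr :=
  fun phi => integral_rV (fun x => f x * phi x).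

Definition distr_partial (k : 'I_n) T : distr :=
  fun phi => - T (partial k phi).

Definition distr_mulX (k : 'I_n) T : distr :=
  fun phi => T (fun x => x 0 k * phi x).

Definition distr_coincides T g : Prop :=
  forall phi, schwartz phi -> T phi = distr_of_fun g phi.

(* The nonzero integers of absolute value at most n: [(false, k)] stands for
   k + 1 and [(true, k)] for - (k + 1), as 'I_n is numbered from 0. *)
Definition hindex : Type := bool * 'I_n.

(* A_{+-k} = +- d/dx_k + x_k *)
Definition distr_A (i : hindex) T : distr :=
  fun phi => (-1) ^+ i.1 * distr_partial i.2 T phi + distr_mulX i.2 T phi.

Definition riesz1 (i : hindex) u : distr :=
  distr_A i (distr_of_fun (H_negpow 2^-1 u)).

Definition riesz2 (i j : hindex) u : distr :=
  distr_A i (distr_A j (distr_of_fun (H_negpow 1 u))).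

End hermite.

(* Main.v *)
(* Put r = sqrt (tanh 2t) and c = 1 / cosh 2t, so that c^2 + r^4 = 1 and the
   Mehler kernel is a product of Gaussians in z_k - c x_k of width r.  Applying
   to it a word w of operators A_i in x multiplies it by r^-|w| times a
   polynomial in r x_k and (z_k - c x_k) / r, hence the resulting operator W_w(t)
   satisfies, for w nonempty,
     |W_w(t) u (x)| <= C ||u|| r^(alpha - |w|) sqrt c <= C' ||u|| t^((alpha - d) / 2)
   for every d >= |w|: split u(z) = (u(z) - u(x)) + u(x), use the Hoelder
   seminorm on the first part, and on the second one use the growth seminorm
   together with the decay in x of the total integral of the kernel.
   Since x_k and d/dx_k are half-sums and half-differences of A_k and A_-k, the
   bound for |w| + 1 controls the increments and the growth of W_w(t) u.  For
   |w| = 2 sigma, the integral of t^(sigma - 1) W_w(t) u is then in the space,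
   because the time integral of min(t^(a - 1), d t^(a - 3/2)) with a = alpha / 2
   is at most a constant times d^alpha.  Finally this integral is the Riesz
   transform, by Fubini and integration by parts against test functions. *)

Require Import Defs.
From mathcomp Require Import all_boot all_order all_algebra.
From mathcomp Require Import all_classical all_reals all_analysis.
From mathcomp Require Import measurable_realfun ring lra.
Import Order.TTheory GRing.Theory Num.Theory.
Import numFieldNormedType.Exports.
Local Open Scope classical_set_scope.
Local Open Scope ring_scope.
Set Implicit Arguments.
Unset Strict Implicit.
Unset Printing Implicit Defensive.

(** * Fubini and Lebesgue measure on tuples *)

(** The obstacle is that the time integral cannot be differentiated once more: for |w| = 2 sigma its
    integrand has size t^(alpha/2 - 1) near 0, and one more letter makes it t^(alpha/2 - 3/2), which
    is not integrable. So increments and growth are estimated for each t, with d = |x - y| or d = 1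
    / (1 + |x|) in the minimum, and operators pass under the time integral only weakly and only
    while words keep length at most 2 sigma. The kernel is centred at c x and not at x. As c^2 + r^4
    = 1 gives 1 - c <= r^2, the displacement (1 - c) x costs at most r |r x|, which the Gaussian in
    r x absorbs. The total integral of the kernel is a polynomial of degree at most |w| in x times a
    Gaussian in r x; after division by (1 + |x|)^alpha it is of size r^(alpha - |w|) because |w| >=
    1 > alpha, which is why w is nonempty there. The factor sqrt c decays exponentially in t, so a
    single power of t serves at 0 and at infinity, for all words of bounded length. The empty word,
    bounded by the supremum of u alone, is included: this gives the absolute convergence of the
    negative powers of H. *)

Section integrable_dom.
Context d (T : measurableType d) (R : realType).
Variable m : {measure set T -> \bar R}.

Lemma integrable_dom (D : set T) (f g : T -> R) : measurable D ->
  measurable_fun D f -> m.-integrable D (EFin \o g) ->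
  (forall x, D x -> `|f x| <= g x) -> m.-integrable D (EFin \o f).
Proof.
move=> mD mf ig fg; apply: (@le_integrable _ _ _ m D mD _ (EFin \o g)) => //.
  exact/measurable_EFinP.
move=> x Dx /=; rewrite lee_fin (le_trans (fg x Dx))//; exact: ler_norm.
Qed.

Lemma Rintegral_dom (D : set T) (f g : T -> R) : measurable D ->
  measurable_fun D f -> m.-integrable D (EFin \o g) ->
  (forall x, D x -> `|f x| <= g x) ->
  `|\int[m]_(x in D) f x| <= \int[m]_(x in D) g x.
Proof.
move=> mD mf ig fg; have iF := integrable_dom mD mf ig fg.
apply: le_trans (le_normr_Rintegral mD iF) _.
apply: le_Rintegral => //; exact: (@integrable_norm _ _ _ m D f iF).
Qed.

Lemma Rintegral_eq0 (f : T -> R) : (forall x, f x = 0) ->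
  \int[m]_x f x = 0.
Proof.
by move=> f0; rewrite /Rintegral integral0_eq// => x _; rewrite f0.
Qed.

End integrable_dom.

Section fubini_dom.
Context d1 d2 (T1 : measurableType d1) (T2 : measurableType d2) (R : realType).
Variable m1 : {sigma_finite_measure set T1 -> \bar R}.
Variable m2 : {sigma_finite_measure set T2 -> \bar R}.

Lemma measurable_slice1 d3 (T3 : measurableType d3) (f : T1 * T2 -> T3) x :
  measurable_fun setT f -> measurable_fun setT (fun y => f (x, y)).
Proof. by move=> mf; apply: measurableT_comp => //; exact: pair1_measurable. Qed.

Lemma measurable_slice2 d3 (T3 : measurableType d3) (f : T1 * T2 -> T3) y :
  measurable_fun setT f -> measurable_fun setT (fun x => f (x, y)).
Proof. by move=> mf; apply: measurableT_comp => //; exact: pair2_measurable. Qed.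

(** The positive and negative parts of the slices have measurable integrals by Tonelli; the integral
    is their difference, and [fine] sends infinite values to 0. *)
Lemma measurable_Rintegral1 (f : T1 * T2 -> R) : measurable_fun setT f ->
  measurable_fun setT (fun x => \int[m2]_y f (x, y)).
Proof.
move=> mf; rewrite /Rintegral.
apply: (@measurableT_comp _ _ _ _ _ _ (@fine R)) => //.
have mef : measurable_fun setT (EFin \o f) by exact/measurable_EFinP.
under eq_fun do rewrite integralE.
apply: emeasurable_funB.
- rewrite (_ : (fun x => _) = fubini_F m2 (EFin \o f)^\+%E); last first.
    apply/funext => x; apply: eq_integral => y _.
    by rewrite (funepos_comp (EFin \o f) (pair x)).
  apply: measurable_fun_fubini_tonelli_F; first exact: measurable_funepos.
  by move=> x; exact: funepos_ge0.
- rewrite (_ : (fun x => _) = fubini_F m2 (EFin \o f)^\-%E); last first.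
    apply/funext => x; apply: eq_integral => y _.
    by rewrite (funeneg_comp (EFin \o f) (pair x)).
  apply: measurable_fun_fubini_tonelli_F; first exact: measurable_funeneg.
  by move=> x; exact: funeneg_ge0.
Qed.

Variables (f : T1 * T2 -> R) (g : T1 -> R) (h : T2 -> R).
Hypothesis mf : measurable_fun setT f.
Hypothesis ig : m1.-integrable setT (EFin \o g).
Hypothesis ih : m2.-integrable setT (EFin \o h).
Hypothesis fgh : forall x y, `|f (x, y)| <= g x * h y.

Lemma integrable_prod_dom : (m1 \x m2)%E.-integrable setT (EFin \o f).
Proof.
apply/(integrable12ltyP m1 m2); first exact/measurable_EFinP.
have h0 : (0 <= \int[m2]_y `|(EFin \o h) y|)%E by exact: integral_ge0.
have hfin : (\int[m2]_y `|(EFin \o h) y|)%E \is a fin_num.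
  by rewrite ge0_fin_numE//; case/integrableP : ih.
apply: (@le_lt_trans _ _ (\int[m1]_x (`|(EFin \o g) x| *
    \int[m2]_y `|(EFin \o h) y|))%E); last first.
  rewrite -(fineK hfin) ge0_integralZr//; last 2 first.
    by apply: measurableT_comp => //; exact: (measurable_int m1).
    by rewrite lee_fin fine_ge0.
  rewrite fineK// lte_mul_pinfty//; first exact: integral_ge0.
  - rewrite ge0_fin_numE; last exact: integral_ge0.
    by case/integrableP : ig.
  - by case/integrableP : ih.
apply: ge0_le_integral => //.
- by move=> x _; exact: integral_ge0.
- apply: (@measurable_fun_fubini_tonelli_F _ _ _ _ _ m2 (fun z => `|(EFin \o f) z|)%E) => //.
  by apply: measurableT_comp => //; exact/measurable_EFinP.
- apply: emeasurable_funM; last exact: measurable_cst.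
  by apply: measurableT_comp => //; exact: (measurable_int m1).
- move=> x _; rewrite -ge0_integralZl//; last 1 first.
    by apply: measurableT_comp => //; exact: (measurable_int m2).
  apply: ge0_le_integral => //.
  + apply: measurableT_comp => //; apply/measurable_EFinP.
    exact: measurable_slice1.
  + apply: emeasurable_funM; first exact: measurable_cst.
    by apply: measurableT_comp => //; exact: (measurable_int m2).
  + move=> y _ /=; rewrite -EFinM lee_fin (le_trans (fgh x y))//.
    by rewrite -normrM; exact: ler_norm.
Qed.

Lemma integrable_slice1 x : m2.-integrable setT (EFin \o (fun y => f (x, y))).
Proof.
apply: (@integrable_dom _ _ _ _ _ _ (fun y => g x * h y)) => //.
  exact: measurable_slice1.
by have := integrableZl measurableT (g x) ih.
Qed.

Lemma integrable_slice2 y : m1.-integrable setT (EFin \o (fun x => f (x, y))).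
Proof.
apply: (@integrable_dom _ _ _ _ _ _ (fun x => g x * h y)) => //.
  exact: measurable_slice2.
have -> : EFin \o (fun x => g x * h y) = (fun x => (h y)%:E * (EFin \o g) x)%E.
  by apply/funext => x /=; rewrite mulrC EFinM.
exact: integrableZl.
Qed.

Lemma Rintegral_prod1 : \int[(m1 \x m2)%E]_z f z = \int[m1]_x \int[m2]_y f (x, y).
Proof.
rewrite /Rintegral -(integral12_prod_meas1 integrable_prod_dom).
congr fine; apply: eq_integral => x _; rewrite /fubini_F fineK//.
exact: integrable_fin_num (integrable_slice1 x).
Qed.

Lemma Rintegral_prod2 : \int[(m1 \x m2)%E]_z f z = \int[m2]_y \int[m1]_x f (x, y).
Proof.
rewrite /Rintegral -(integral21_prod_meas1 integrable_prod_dom).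
congr fine; apply: eq_integral => x _; rewrite /fubini_G fineK//.
exact: integrable_fin_num (integrable_slice2 x).
Qed.

Lemma Rfubini :
  \int[m1]_x \int[m2]_y f (x, y) = \int[m2]_y \int[m1]_x f (x, y).
Proof. by rewrite -Rintegral_prod1 Rintegral_prod2. Qed.

End fubini_dom.

Section tuple_integral.
Context (R : realType).
Local Notation mR := (measurableTypeR R).
Local Notation leb := (@lebesgue_measure R).

Lemma ge0_integral_tuple_cons n (f : n.+1.-tuple mR -> \bar R) :
  measurable_fun setT f -> (forall t, 0 <= f t)%E ->
  (\int[lebesgue_tuple R n.+1]_t f t =
   \int[leb]_x \int[lebesgue_tuple R n]_t f (tcons (x, t)))%E.
Proof.
move=> mf f0 /=.
rewrite [LHS](@ge0_integral_pushforward _ _ _ _ _ _ (@measurable_tcons R n))//.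
rewrite preimage_setT (fubini_tonelli1 (f \o @tcons R n))//; last first.
  by move=> x; exact: f0.
by apply: measurableT_comp => //; exact: measurable_tcons.
Qed.

Lemma ge0_integral_tuple0 (f : 0.-tuple mR -> \bar R) :
  measurable_fun setT f -> (forall t, 0 <= f t)%E ->
  (\int[lebesgue_tuple R 0]_t f t = f [tuple])%E.
Proof. by move=> mf f0 /=; rewrite integral_dirac// diracT mul1e. Qed.

Lemma measurable_prod_tnth n (f : 'I_n -> mR -> R) :
  (forall k, measurable_fun setT (f k)) ->
  measurable_fun setT (fun t : n.-tuple mR => \prod_k f k (tnth t k)).
Proof.
move=> mf; apply: measurable_prod => k _.
exact: (measurableT_comp (mf k) (measurable_tnth k)).
Qed.

Lemma tnth_tcons0 n x (t : n.-tuple mR) : tnth (tcons (x, t)) ord0 = x.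
Proof. by rewrite (tnth_nth x). Qed.

Lemma tnth_tconsS n x (t : n.-tuple mR) k :
  tnth (tcons (x, t)) (lift ord0 k) = tnth t k.
Proof. by rewrite !(tnth_nth x). Qed.

Lemma ge0_integral_prod_tnth n (f : 'I_n -> mR -> R) :
  (forall k, measurable_fun setT (f k)) -> (forall k x, 0 <= f k x) ->
  (\int[lebesgue_tuple R n]_t (\prod_k f k (tnth t k))%:E =
   \prod_k (\int[leb]_x (f k x)%:E))%E.
Proof.
elim: n f => [f mf f0|n IH f mf f0].
  rewrite ge0_integral_tuple0 ?big_ord0//.
  - by apply/measurable_EFinP; exact: measurable_prod_tnth.
  - by move=> t; rewrite lee_fin prodr_ge0.
rewrite ge0_integral_tuple_cons; last 2 first.
  - by apply/measurable_EFinP; exact: measurable_prod_tnth.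
  - by move=> t; rewrite lee_fin prodr_ge0.
rewrite big_ord_recl.
pose g (k : 'I_n) := f (lift ord0 k).
transitivity (\int[leb]_x ((f ord0 x)%:E * \prod_k \int[leb]_y (g k y)%:E))%E.
  apply: eq_integral => x _; rewrite -IH; last 2 first.
  - by move=> k; apply: mf.
  - by move=> k y; apply: f0.
  rewrite -ge0_integralZl//.
    - apply: eq_integral => t _; rewrite big_ord_recl tnth_tcons0 -EFinM.
      congr (_ * _)%:E; apply: eq_bigr => k _; rewrite /g; congr (f _ _).
      exact: tnth_tconsS.
    - apply/measurable_EFinP; apply: measurable_prod_tnth => k; exact: mf.
    - by move=> t _; rewrite lee_fin prodr_ge0// => k _; exact: f0.
    - by rewrite lee_fin.
rewrite ge0_integralZr//.
- exact/measurable_EFinP.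
- by move=> x _; rewrite lee_fin.
- by apply: prode_ge0 => k _; apply: integral_ge0 => y _; rewrite lee_fin f0.
Qed.

Lemma integrable_prod_tnth n (f : 'I_n -> mR -> R) :
  (forall k x, 0 <= f k x) ->
  (forall k, leb.-integrable setT (EFin \o f k)) ->
  (lebesgue_tuple R n).-integrable setT
    (EFin \o (fun t => \prod_k f k (tnth t k))).
Proof.
move=> f0 fi; have mf k : measurable_fun setT (f k).
  by apply/measurable_EFinP; exact: (measurable_int leb).
apply/integrableP; split.
  by apply/measurable_EFinP; exact: measurable_prod_tnth.
under eq_integral.
  move=> t _; rewrite gee0_abs/=; last by rewrite lee_fin prodr_ge0.
  over.
rewrite ge0_integral_prod_tnth//.
rewrite (eq_bigr (fun k => (\int[leb]_x f k x)%:E)).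
  by rewrite -(big_morph EFin EFinM erefl) ltry.
by move=> k _; rewrite /Rintegral fineK//; exact: integrable_fin_num (fi k).
Qed.

Lemma Rintegral_prod_tnth n (f : 'I_n -> mR -> R) :
  (forall k x, 0 <= f k x) ->
  (forall k, leb.-integrable setT (EFin \o f k)) ->
  \int[lebesgue_tuple R n]_t (\prod_k f k (tnth t k)) =
   \prod_k (\int[leb]_x (f k x)).
Proof.
move=> f0 fi; have mf k : measurable_fun setT (f k).
  by apply/measurable_EFinP; exact: (measurable_int leb).
rewrite {1}/Rintegral ge0_integral_prod_tnth//.
rewrite (eq_bigr (fun k => (\int[leb]_x f k x)%:E)).
  by rewrite -(big_morph EFin EFinM erefl).
by move=> k _; rewrite /Rintegral fineK//; exact: integrable_fin_num (fi k).
Qed.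

Definition tupd n (t : n.-tuple mR) (k : 'I_n) (y : R) : n.-tuple mR :=
  [tuple if j == k then y else tnth t j | j < n].

Lemma tnth_tupd n (t : n.-tuple mR) k y j :
  tnth (tupd t k y) j = if j == k then y else tnth t j.
Proof. by rewrite tnth_mktuple. Qed.

Lemma tupd_tcons0 n x (t : n.-tuple mR) y :
  tupd (tcons (x, t)) ord0 y = tcons (y, t).
Proof.
apply: eq_from_tnth => j; rewrite tnth_tupd.
case: (unliftP ord0 j) => [k ->|->]; last by rewrite eqxx tnth_tcons0.
by rewrite !tnth_tconsS.
Qed.

Lemma tupd_tconsS n x (t : n.-tuple mR) k y :
  tupd (tcons (x, t)) (lift ord0 k) y = tcons (x, tupd t k y).
Proof.
apply: eq_from_tnth => j; rewrite tnth_tupd.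
case: (unliftP ord0 j) => [i ->|->]; last by rewrite !tnth_tcons0.
by rewrite !tnth_tconsS tnth_tupd (inj_eq (@lift_inj _ ord0)).
Qed.

(** Meant for a function that is a k-th partial derivative. Freezing the first coordinate keeps a
    majorant in product form, with constant [B * rho x], so induction on the dimension reaches
    coordinate k; there Fubini integrates that coordinate innermost. *)
Lemma Rintegral_slice0 n (k : 'I_n) (f : n.-tuple mR -> R) (rho : mR -> R) B :
  measurable_fun setT f -> leb.-integrable setT (EFin \o rho) ->
  (forall y, 0 <= rho y) ->
  (forall t, `|f t| <= B * \prod_j rho (tnth t j)) ->
  (forall t, \int[leb]_y f (tupd t k y) = 0) ->
  \int[lebesgue_tuple R n]_t f t = 0.
Proof.
elim: n k f B => [[]//|n IH k f B mf irho rho0 frho f0].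
have mfc : measurable_fun setT (f \o @tcons R n).
  by apply: measurableT_comp => //; exact: measurable_tcons.
have ig : leb.-integrable setT (EFin \o (fun x => B * rho x)).
  exact: (integrableZl measurableT B irho).
have ih : (lebesgue_tuple R n).-integrable setT
    (EFin \o (fun t => \prod_j rho (tnth t j))).
  exact: (@integrable_prod_tnth n (fun=> rho)).
have fgh x t : `|(f \o @tcons R n) (x, t)| <= B * rho x * \prod_j rho (tnth t j).
  apply: le_trans (frho _) _; rewrite big_ord_recl tnth_tcons0 mulrA.
  by rewrite le_eqVlt; apply/orP; left; apply/eqP; congr (_ * _);
    apply: eq_bigr => j _; rewrite tnth_tconsS.
have -> : \int[lebesgue_tuple R n.+1]_t f t =
    \int[(leb \x lebesgue_tuple R n)%E]_z (f \o @tcons R n) z.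
  rewrite /Rintegral/= (@integral_pushforward _ _ _ _ _ _ (@measurable_tcons R n))//.
  - exact/measurable_EFinP.
  - exact: (integrable_prod_dom mfc ig ih fgh).
case: (unliftP ord0 k) => [k' kk'|k0].
  rewrite (Rintegral_prod1 mfc ig ih fgh).
  apply: Rintegral_eq0 => x.
  apply: (IH k' _ (B * rho x)) => //.
  - exact: (measurable_slice1 x mfc).
  - by move=> t; rewrite -[RHS](f0 (tcons (x, t))) kk'; apply: eq_Rintegral => y _;
      rewrite tupd_tconsS.
rewrite (Rintegral_prod2 mfc ig ih fgh).
apply: Rintegral_eq0 => t.
rewrite -[RHS](f0 (tcons (0, t))) k0; apply: eq_Rintegral => y _.
by rewrite tupd_tcons0.
Qed.

Lemma tuple_rVE n (t : n.-tuple mR) k : tuple_rV t 0 k = tnth t k.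
Proof. by rewrite mxE. Qed.

(** The sigma-algebra on tuples is the product one, so measurability is obtained by approximation:
    rounding every coordinate down to a multiple of 1 / (k + 1) makes f factor through the countable
    set of integer tuples, and by continuity f is the limit of these functions. *)
Lemma continuous_measurable_rV n (f : 'rV[R]_n -> R) :
  continuous f -> measurable_fun setT (f \o @tuple_rV R n).
Proof.
move=> cf.
pose r k (t : n.-tuple mR) : 'rV[R]_n :=
  \row_j ((Num.floor (tnth t j * k.+1%:R))%:~R / k.+1%:R).
have mr k : measurable_fun setT (f \o r k).
  pose g (m : n.-tuple int) : R := f (\row_j ((tnth m j)%:~R / k.+1%:R)).
  pose h (t : n.-tuple mR) : n.-tuple int :=
    [tuple Num.floor (tnth t j * k.+1%:R) | j < n].
  have -> : f \o r k = g \o h.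
    apply/funext => t /=; rewrite /g; congr f; apply/rowP => j.
    by rewrite !mxE tnth_mktuple.
  have mh (m : n.-tuple int) : measurable (h @^-1` [set m]).
    have -> : h @^-1` [set m] = \bigcap_(j in [set: 'I_n])
        ((fun t : n.-tuple mR => tnth t j) @^-1`
        `[(tnth m j)%:~R / k.+1%:R, (tnth m j + 1)%:~R / k.+1%:R[%classic).
      have E (t : n.-tuple mR) j : Num.floor (tnth t j * k.+1%:R) = tnth m j <->
          (tnth t j \in `[(tnth m j)%:~R / k.+1%:R, (tnth m j + 1)%:~R / k.+1%:R[).
        rewrite in_itv/= ler_pdivrMr ?ltr0n// ltr_pdivlMr ?ltr0n// -floor_eq.
        by split => /eqP.
      apply/seteqP; split => t /=.
        by move=> hm j _ /=; apply/E; rewrite -hm tnth_mktuple.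
      move=> H; apply: eq_from_tnth => j.
      by rewrite tnth_mktuple; apply/E; exact: H.
    apply: fin_bigcap_measurable => [|j _]; first exact: finite_finset.
    by rewrite -[X in measurable X]setTI; apply: measurable_tnth.
  move=> _ Y mY; rewrite setTI comp_preimage.
  have -> : h @^-1` (g @^-1` Y) = \bigcup_(m in g @^-1` Y) (h @^-1` [set m]).
    apply/seteqP; split => [t Yt|t [m Ym hm]]; first by exists (h t).
    by rewrite /preimage/= hm.
  rewrite bigcup_mkcond; apply: countable_bigcupT_measurable => // m.
  by case: ifP => _; [exact: mh|exact: measurable0].
apply: (@measurable_fun_cvg _ _ _ _ (fun k => f \o r k)) => //.
move=> t _; suff rt : r k t @[k --> \oo] --> tuple_rV t.
  exact: (cvg_comp (fun k => r k t) f rt (cf (tuple_rV t))).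
apply/cvg_ballP => e e0; near=> k; split => // i j.
rewrite ord1 !mxE /ball/=.
have k0 : (0 : R) < k.+1%:R by rewrite ltr0n.
have /andP[h1 h2] := floor_itv (tnth t j * k.+1%:R).
rewrite ger0_norm; last by rewrite subr_ge0 ler_pdivrMr.
apply: (@le_lt_trans _ _ k.+1%:R^-1).
  rewrite lerBlDr -(ler_pM2r k0) mulrDl mulVf ?gt_eqF// divfK ?gt_eqF//.
  by rewrite intrD addrC in h2; exact: ltW.
by near: k; exact: near_infty_natSinv_lt (PosNum e0).
Unshelve. all: by end_near. Qed.

End tuple_integral.

(** * Integrals on the real line *)

Section real_integrals.
Context (R : realType).
Local Notation mR := (measurableTypeR R).
Local Notation leb := (@lebesgue_measure R).

(** An integrable weight whose products over the coordinates dominate rapidly decreasing functions,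
    and whose decay removes the boundary terms in integrations by parts. *)
Definition cauchy_fun (y : mR) : R := (oneDsqr (y : R))^-1.

Lemma cauchy_fun_gt0 y : 0 < cauchy_fun y.
Proof. by rewrite /cauchy_fun invr_gt0 (lt_le_trans ltr01)// oneDsqr_ge1. Qed.

Lemma measurable_cauchy_fun : measurable_fun setT cauchy_fun.
Proof. exact: (continuous_measurable_fun (@continuous_oneDsqrV R)). Qed.

Lemma integrable_cauchy_fun : leb.-integrable setT (EFin \o cauchy_fun).
Proof.
apply/integrableP; split; first by apply/measurable_EFinP; apply: measurable_cauchy_fun.
under eq_integral.
  move=> y _; rewrite gee0_abs/=; last by rewrite lee_fin ltW ?cauchy_fun_gt0.
  over.
rewrite (@ge0_symfun_integralT _ cauchy_fun).
- by rewrite -set_itvcy integral0y_oneDsqr -EFinM ltry.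
- by move=> y; rewrite ltW ?cauchy_fun_gt0.
- exact: (@continuous_oneDsqrV R).
- by move=> y /=; rewrite /cauchy_fun /oneDsqr sqrrN.
Qed.

(** Up to its peak value this is the normal density of mean m and variance a / 2. *)
Lemma gauss_integrable (m a : R) : 0 < a ->
  leb.-integrable setT (EFin \o (fun z : mR => expR (- ((z : R) - m) ^+ 2 / a))).
Proof.
move=> a0; pose s := Num.sqrt (a / 2).
have s0 : s != 0 by rewrite gt_eqF// sqrtr_gt0 divr_gt0.
have := integrableZl measurableT (normal_peak s)^-1 (integrable_normal_pdf m s).
apply: eq_integrable => // z _ /=.
rewrite (normal_pdfE m s0) -EFinM mulKf ?gt_eqF ?normal_peak_gt0//.
congr (expR (_ / _))%:E.
by rewrite /s sqr_sqrtr ?divr_ge0 ?ltW// -mulr_natr divfK.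
Qed.

Lemma gauss_Rintegral (m a : R) : 0 < a ->
  \int[leb]_z expR (- ((z : R) - m) ^+ 2 / a) = Num.sqrt (a * pi).
Proof.
move=> a0; pose s := Num.sqrt (a / 2).
have s0 : s != 0 by rewrite gt_eqF// sqrtr_gt0 divr_gt0.
have E : s ^+ 2 *+ 2 = a.
  by rewrite /s sqr_sqrtr ?divr_ge0 ?ltW// -mulr_natr divfK.
have -> : Num.sqrt (a * pi) = (normal_peak s)^-1.
  by rewrite /normal_peak invrK -mulrnAl E.
apply: (@mulfI _ (normal_peak s)); first by rewrite gt_eqF ?normal_peak_gt0.
rewrite mulfV ?gt_eqF ?normal_peak_gt0// -RintegralZl//.
  rewrite -[RHS]/(fine 1%:E) -(integral_normal_pdf m s) /Rintegral.
  congr fine; apply: eq_integral => z _.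
  by rewrite (normal_pdfE m s0) /normal_fun E.
exact: gauss_integrable.
Qed.

(** The integral over a growing symmetric interval is a difference of boundary values of F, which
    tends to 0; dominated convergence identifies the limit with the full integral. *)
Lemma Rintegral_derive0 (F f : mR -> R) (B : R) :
  (forall y : R, is_derive (y : R) 1 (F : R -> R) (f y)) ->
  continuous (f : R -> R) ->
  (forall y, `|F y| <= B * cauchy_fun y) ->
  leb.-integrable setT (EFin \o f) -> \int[leb]_y f y = 0.
Proof.
move=> dF cf FB fi.
pose D k := `[- k%:R, k%:R]%classic : set mR.
have B0 : 0 <= B.
  by have := FB 0; rewrite -(pmulr_lge0 _ (cauchy_fun_gt0 0)); exact: le_trans.
have mf : measurable_fun setT (EFin \o f) by exact: (measurable_int leb).
have cvg1 : (\int[leb]_(y in setT) (((EFin \o f) \_ (D k)) y))%E @[k --> \oo] -->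
    (\int[leb]_(y in setT) ((EFin \o f) y))%E.
  apply: (@dominated_cvg _ _ _ leb setT measurableT _ _ (abse \o (EFin \o f))) => //.
  - move=> k; apply/(measurable_restrictT _ _).1 => //; first exact: measurable_itv.
    exact: measurable_funTS.
  - move=> y _; apply: cvg_near_cst; near=> k; rewrite patchE mem_set//.
    rewrite /D/= in_itv/= -ler_norml.
    by near: k; exact: nbhs_infty_ger.
  - exact: integrable_abse.
  - move=> k y _; rewrite patchE; case: ifPn => // _.
    by rewrite abse0 abse_ge0.
(* The index is shifted because the interval of index 0 is a single point, to which the fundamental
   theorem of calculus is not applied. *)
have eqk k : (\int[leb]_(y in setT) (((EFin \o f) \_ (D k.+1)) y))%E =
    (F k.+1%:R - F (- k.+1%:R))%:E.
  rewrite -integral_mkcond EFinB; apply: (@continuous_FTC2 R f F).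
  - by rewrite (@lt_trans _ _ 0) ?oppr_lt0 ?ltr0n.
  - exact: continuous_subspaceT.
  - have cF : continuous (F : R -> R).
      move=> y; apply: differentiable_continuous; apply/derivable1_diffP.
      exact: (@ex_derive _ _ _ _ _ _ _ (dF y)).
    split.
    + by move=> y _; exact: (@ex_derive _ _ _ _ _ _ _ (dF y)).
    + exact/cvg_at_right_filter/cF.
    + exact/cvg_at_left_filter/cF.
  - by move=> y _; rewrite derive1E; exact: (@derive_val _ _ _ _ _ _ _ (dF y)).
have cvg2 : (F k.+1%:R - F (- k.+1%:R))%:E @[k --> \oo] --> 0%:E.
  apply: cvg_EFin; first exact: nearW.
  have hB k : `|F k.+1%:R - F (- k.+1%:R)| <= (B *+ 2) * harmonic k.
    have hc (y : R) : `|y| = k.+1%:R -> `|F y| <= B * k.+1%:R^-1.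
      move=> yk; apply: le_trans (FB y) _; apply: ler_wpM2l => //.
      rewrite /cauchy_fun lef_pV2 ?posrE ?ltr0n//.
      rewrite /oneDsqr -real_normK ?num_real// yk.
      have : (1 : R) <= k.+1%:R by rewrite ler1n.
      nra.
    rewrite (le_trans (ler_normB _ _))// mulrnAl mulr2n lerD// hc ?normrN//.
      by rewrite ger0_norm.
    by rewrite ger0_norm.
  have h0 : ((B *+ 2) * harmonic k : R) @[k --> \oo] --> (0 : R).
    by rewrite -(mulr0 (B *+ 2)); apply: cvgMl_tmp; exact: cvg_harmonic.
  have h1 : - ((B *+ 2) * harmonic k : R) @[k --> \oo] --> (0 : R).
    by rewrite -oppr0; exact: cvgN.
  apply: (squeeze_cvgr _ h1 h0); apply: nearW => k; rewrite -ler_norml; exact: hB.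
rewrite /Rintegral; suff -> : (\int[leb]_(y in setT) ((EFin \o f) y))%E = 0%:E by [].
apply: (cvg_unique _ _ cvg2); first exact: ereal_hausdorff.
have := cvg1; rewrite -cvg_shiftS; under eq_fun do rewrite eqk; exact.
Unshelve. all: by end_near. Qed.

Lemma continuous_powR (a : R) (x : R) : 0 < x -> {for x, continuous ((@powR R)^~ a)}.
Proof.
move=> x0; apply: differentiable_continuous; apply/derivable1_diffP.
exact: (@ex_derive _ _ _ _ _ _ _ (is_derive1_powR a x0)).
Qed.

(** The integrand may be singular at 0, so the interval is exhausted by [1 / (n + 1), b], where the
    fundamental theorem of calculus applies; dropping the lower boundary term leaves a bound uniform
    in n. *)
Lemma integral_powR_0b (a b : R) : 0 < a -> 0 < b ->
  (\int[leb]_(t in `]0%R, b]) (t `^ (a - 1))%:E <= (b `^ a / a)%:E)%E.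
Proof.
move=> a0 b0; rewrite itv_open_bnd_bigcup.
set S := fun n => _.
have mS n : measurable_fun (S n) (fun t : mR => (t `^ (a - 1))%:E).
  apply/measurable_EFinP; apply: measurable_funTS; exact: measurable_powR.
have ndS : {homo S : n m / (n <= m)%N >-> (n <= m)%O}.
  move=> n m nm; apply/subsetPset; apply: subset_itvr; rewrite bnd_simp !add0r.
  by rewrite lef_pV2 ?posrE ?ltr0n// ler_nat.
have mSn n : measurable (S n : set mR) by exact: measurable_itv.
have S0 n (x : mR) : S n x -> (0 <= (x `^ (a - 1))%:E)%E.
  by rewrite lee_fin powR_ge0.
have /cvg_lim <- // := ge0_nondecreasing_set_cvg_integral (mu := leb) ndS mSn mS S0.
apply: lime_le.
  apply: ereal_nondecreasing_is_cvgn; apply: ge0_nondecreasing_set_nondecreasing_integral => //.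
apply: nearW => n; rewrite /S add0r.
have n0 : (0 : R) < n.+1%:R^-1 by rewrite invr_gt0 ltr0n.
have [bn|nb] := leP b (n.+1%:R^-1).
  move: bn; rewrite le_eqVlt => /orP[/eqP <-|bn].
    by rewrite set_itv1 integral_set1 lee_fin divr_ge0 ?powR_ge0// ltW.
  rewrite set_itv_ge ?bnd_simp -?ltNge// integral_set0.
  by rewrite lee_fin divr_ge0 ?powR_ge0// ltW.
have dF (x : R) : 0 < x -> is_derive x 1 (fun t : R => t `^ a / a) (x `^ (a - 1)).
  move=> x0; have := is_deriveM (is_derive1_powR a x0) (is_derive_cst a^-1 x 1).
  rewrite scaler0 add0r => h; apply: is_derive_eq.
  by rewrite /cst/= scalerA mulVf ?scale1r// gt_eqF.
rewrite (@continuous_FTC2 R ((@powR R)^~ (a - 1)) (fun t => t `^ a / a))//.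
- rewrite -EFinB lee_fin lerBlDr lerDl divr_ge0 ?powR_ge0// ltW//.
- apply: continuous_in_subspaceT => x; rewrite inE/= in_itv/= => /andP[nx _].
  by apply: continuous_powR; exact: lt_le_trans nx.
- have cF x : 0 < x -> {for x, continuous (fun t : R => t `^ a / a)}.
    move=> x0; apply: differentiable_continuous; apply/derivable1_diffP.
    exact: (@ex_derive _ _ _ _ _ _ _ (dF _ x0)).
  split.
  + move=> x; rewrite in_itv/= => /andP[nx _].
    exact: (@ex_derive _ _ _ _ _ _ _ (dF _ (lt_trans n0 nx))).
  + exact/cvg_at_right_filter/cF.
  + exact/cvg_at_left_filter/cF.
- move=> x; rewrite in_itv/= => /andP[nx _]; rewrite derive1E.
  exact: (@derive_val _ _ _ _ _ _ _ (dF _ (lt_trans n0 nx))).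
Qed.

Lemma integral_powR_by (a b : R) : 0 < a -> 0 < b ->
  (\int[leb]_(t in `[b, +oo[) (t `^ (- a - 1))%:E = (b `^ (- a) / a)%:E)%E.
Proof.
move=> a0 b0.
have dF (x : R) : 0 < x -> is_derive x 1 (fun t : R => - (t `^ (- a) / a)) (x `^ (- a - 1)).
  move=> x0.
  have := is_deriveN (is_deriveM (is_derive1_powR (- a) x0) (is_derive_cst a^-1 x 1)).
  rewrite scaler0 add0r => h; apply: is_derive_eq.
  by rewrite /cst/= scalerA mulrN mulVf ?gt_eqF// scaleN1r opprK.
have cF x : 0 < x -> {for x, continuous (fun t : R => - (t `^ (- a) / a))}.
  move=> x0; apply: differentiable_continuous; apply/derivable1_diffP.
  exact: (@ex_derive _ _ _ _ _ _ _ (dF _ x0)).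
rewrite (@ge0_continuous_FTC2y R (fun t => t `^ (- a - 1)) (fun t => - (t `^ (- a) / a)) b 0).
- by rewrite -EFinB sub0r opprK.
- by move=> x _; exact: powR_ge0.
- apply: continuous_in_subspaceT => x; rewrite inE/= in_itv/= andbT => bx.
  by apply: continuous_powR; exact: lt_le_trans bx.
- rewrite -oppr0; apply: cvgN; rewrite -(mul0r a^-1); apply: cvgMr_tmp.
  apply/cvgrPdist_lt => e e0; near=> t.
  rewrite sub0r normrN ger0_norm ?powR_ge0// powRN invf_plt ?posrE//; last first.
    by rewrite powR_gt0.
  (* Exhibits the threshold e^(-1 / a), beyond which t^(-a) is below e. *)
  have -> : e^-1 = (e^-1 `^ a^-1) `^ a.
    by rewrite -powRrM mulVf ?gt_eqF// powRr1// invr_ge0 ltW.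
  apply: gt0_ltr_powR; rewrite ?nnegrE ?powR_ge0//.
- by move=> x bx; exact: (@ex_derive _ _ _ _ _ _ _ (dF _ (lt_trans b0 bx))).
- exact/cvg_at_right_filter/cF.
- move=> x; rewrite in_itv/= andbT => bx; rewrite derive1E.
  exact: (@derive_val _ _ _ _ _ _ _ (dF _ (lt_trans b0 bx))).
Unshelve. all: by end_near. Qed.

(** The two bounds cross at t = d^2. *)
Definition hmaj (a d t : R) : R := Num.min (t `^ (a - 1)) (d * t `^ (a - 3 / 2)).

Lemma hmaj_ge0 a d t : 0 <= d -> 0 <= hmaj a d t.
Proof. by move=> d0; rewrite le_min powR_ge0 mulr_ge0// powR_ge0. Qed.

Lemma measurable_hmaj a d : measurable_fun setT (hmaj a d : mR -> R).
Proof.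
apply: measurable_minr; first exact: measurable_powR.
by apply: measurable_funM => //; exact: measurable_powR.
Qed.

(** Split at t = d^2. Below, the first bound integrates to d^(2a) / a; above, the second one
    integrates to d * d^(2a - 1) / (1/2 - a). Convergence at 0 and at infinity are the two
    conditions on a. *)
Lemma ge0_integral_hmaj (a d : R) : 0 < a -> a < 1 / 2 -> 0 < d ->
  (\int[leb]_(t in `]0%R, +oo[) (hmaj a d t)%:E <=
   ((a^-1 + (1 / 2 - a)^-1) * d `^ (2 * a))%:E)%E.
Proof.
move=> a0 a1 d0; have d2 : 0 < d ^+ 2 by rewrite exprn_gt0.
have -> : `]0%R, +oo[%classic = `]0%R, d ^+ 2] `|` `]d ^+ 2, +oo[ :> set R.
  apply/seteqP; split => t /=; rewrite !in_itv/= ?andbT.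
    by move=> t0; have [td|td] := leP t (d ^+ 2); [left; rewrite t0|right].
  by move=> [/andP[]//|]; exact: lt_trans.
rewrite ge0_integral_setU//=; last 3 first.
- apply/measurable_EFinP; apply: measurable_funTS; exact: measurable_hmaj.
- by move=> t _; rewrite lee_fin hmaj_ge0// ltW.
- apply/disj_setPS => t /=; rewrite !in_itv/= andbT => -[/andP[_ h1] h2].
  by move: (le_lt_trans h1 h2); rewrite ltxx.
have dd (e : R) : (d ^+ 2) `^ e = d `^ (2 * e).
  by rewrite powRrM powR_mulrn ?ltW.
rewrite mulrDl EFinD; apply: leeD.
  apply: (@le_trans _ _ (\int[leb]_(t in `]0%R, (d ^+ 2)%R]) (t `^ (a - 1))%:E)%E).
    apply: ge0_le_integral => //.
    - by move=> t _; rewrite lee_fin hmaj_ge0// ltW.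
    - apply/measurable_EFinP; apply: measurable_funTS; exact: measurable_hmaj.
    - apply/measurable_EFinP; apply: measurable_funTS; exact: measurable_powR.
    - by move=> t _; rewrite lee_fin ge_min lexx.
  by apply: le_trans (integral_powR_0b a0 d2) _; rewrite dd mulrC.
rewrite integral_itv_obnd_cbnd; last first.
  apply/measurable_EFinP; apply: measurable_funTS; exact: measurable_hmaj.
apply: (@le_trans _ _ (\int[leb]_(t in `[(d ^+ 2)%R, +oo[) (d%:E * (t `^ (- (1 / 2 - a) - 1))%:E))%E).
  apply: ge0_le_integral => //.
  - by move=> t _; rewrite lee_fin hmaj_ge0// ltW.
  - apply/measurable_EFinP; apply: measurable_funTS; exact: measurable_hmaj.
  - apply/measurable_EFinP; apply: measurable_funTS; by apply: measurable_funM => //.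
  - move=> t _; rewrite -EFinM lee_fin ge_min; apply/orP; right.
    by rewrite le_eqVlt; apply/orP; left; apply/eqP; congr (_ * _ `^ _); field.
rewrite ge0_integralZl//=; last 3 first.
- apply/measurable_EFinP; apply: measurable_funTS; exact: measurable_powR.
- by move=> t _; rewrite lee_fin powR_ge0.
- by rewrite lee_fin ltW.
rewrite integral_powR_by//; last by rewrite subr_gt0.
have -> : d `^ (2 * a) = d * (d ^+ 2) `^ (- (1 / 2 - a)).
  have -> : 2 * a = 1 + 2 * (- (1 / 2 - a)) by field.
  rewrite dd powRD; first by rewrite powRr1// ltW.
  by rewrite (gt_eqF d0) implybT.
by rewrite -EFinM lee_fin le_eqVlt; apply/orP; left; apply/eqP; rewrite mulrA mulrC.
Qed.

Lemma integrable_hmaj a d : 0 < a -> a < 1 / 2 -> 0 < d ->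
  leb.-integrable `]0%R, +oo[%classic (EFin \o (hmaj a d : mR -> R)).
Proof.
move=> a0 a1 d0; apply/integrableP; split.
  apply/measurable_EFinP; apply: measurable_funTS; exact: measurable_hmaj.
under eq_integral.
  move=> t _; rewrite /= ger0_norm; last by rewrite hmaj_ge0// ltW.
  over.
by apply: le_lt_trans (ge0_integral_hmaj a0 a1 d0) _; rewrite ltry.
Qed.

Lemma Rintegral_hmaj a d : 0 < a -> a < 1 / 2 -> 0 < d ->
  \int[leb]_(t in `]0%R, +oo[) (hmaj a d t) <=
   (a^-1 + (1 / 2 - a)^-1) * d `^ (2 * a).
Proof.
move=> a0 a1 d0; rewrite -lee_fin /Rintegral fineK.
  exact: ge0_integral_hmaj.
by apply: integrable_fin_num => //; exact: integrable_hmaj.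
Qed.

End real_integrals.

(** * Derivatives of functions of one real variable *)

Section is_derive_real.
Context (R : realType).
Implicit Types (f g : R -> R) (x a b : R).

Lemma is_derive_add f g x a b : is_derive x 1 f a -> is_derive x 1 g b ->
  is_derive x 1 (fun y => f y + g y) (a + b).
Proof. exact: is_deriveD. Qed.

Lemma is_derive_mul f g x a b : is_derive x 1 f a -> is_derive x 1 g b ->
  is_derive x 1 (fun y => f y * g y) (a * g x + f x * b).
Proof.
move=> df dg; have h := is_deriveM df dg.
by apply: is_derive_eq; rewrite /GRing.scale/=; ring.
Qed.

Lemma is_derive_ext f g x a b : (forall y, f y = g y) -> a = b ->
  is_derive x 1 g a -> is_derive x 1 f b.
Proof. by move=> /funext -> ->. Qed.

Lemma is_derive_scale f x a c : is_derive x 1 f a ->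
  is_derive x 1 (fun y => c * f y) (c * a).
Proof.
move=> df; have h := is_derive_mul (is_derive_cst c x 1) df.
by apply: is_derive_eq; rewrite mul0r add0r.
Qed.

Lemma is_derive_exp f x a : is_derive x 1 f a ->
  is_derive x 1 (fun y => expR (f y)) (a * expR (f x)).
Proof.
move=> df; have h := @is_derive1_comp R expR f x _ _ (is_derive_expR (f x)) df.
by apply: is_derive_eq; rewrite mulrC.
Qed.

Lemma is_derive_affine (a b x : R) : is_derive x 1 (fun y => a * y + b) a.
Proof.
have h := is_derive_add (is_derive_scale a (is_derive_id x 1)) (is_derive_cst b x 1).
by apply: is_derive_eq; rewrite addr0 mulr1.
Qed.

Lemma is_derive_continuous f x a : is_derive x 1 f a -> {for x, continuous f}.
Proof.
move=> df; apply: differentiable_continuous; apply/derivable1_diffP.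
exact: (@ex_derive _ _ _ _ _ _ _ df).
Qed.

End is_derive_real.

(** * The Mehler kernel under words of operators A_i *)

Section pexp.
Context (R : realType).

(* A syntax for polynomials in the scalars s, c and the rescaled variables X, Y;
   [pdeg] is the degree in X and Y only. *)
Inductive pexp : Type :=
| PCst of R | PS | PC | PX | PY | PAdd of pexp & pexp | PMul of pexp & pexp.

Fixpoint pev (e : pexp) (s c X Y : R) : R :=
  match e with
  | PCst a => a
  | PS => s | PC => c | PX => X | PY => Y
  | PAdd e1 e2 => pev e1 s c X Y + pev e2 s c X Y
  | PMul e1 e2 => pev e1 s c X Y * pev e2 s c X Y
  end.

Fixpoint pdX e :=
  match e with
  | PX => PCst 1
  | PAdd e1 e2 => PAdd (pdX e1) (pdX e2)
  | PMul e1 e2 => PAdd (PMul (pdX e1) e2) (PMul e1 (pdX e2))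
  | _ => PCst 0
  end.

Fixpoint pdY e :=
  match e with
  | PY => PCst 1
  | PAdd e1 e2 => PAdd (pdY e1) (pdY e2)
  | PMul e1 e2 => PAdd (PMul (pdY e1) e2) (PMul e1 (pdY e2))
  | _ => PCst 0
  end.

Fixpoint pdeg e : nat :=
  match e with
  | PX | PY => 1
  | PAdd e1 e2 => maxn (pdeg e1) (pdeg e2)
  | PMul e1 e2 => (pdeg e1 + pdeg e2)%N
  | _ => 0
  end.

Lemma pdeg_dX e : (pdeg (pdX e) <= pdeg e)%N.
Proof.
elim: e => //= e1 h1 e2 h2; first by rewrite geq_max !leq_max h1 h2 orbT.
by rewrite geq_max leq_add2r h1 leq_add2l h2.
Qed.

(** The scalars [s] and [c] stay in [-1, 1], so they cost only constants; this is why [pdeg] ignores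
    them and C is uniform in time. *)
Lemma pev_bound e : exists2 C : R, 0 <= C & forall s c X Y : R,
  `|s| <= 1 -> `|c| <= 1 -> `|pev e s c X Y| <= C * (1 + `|X| + `|Y|) ^+ pdeg e.
Proof.
have h1 (X Y : R) : 1 <= 1 + `|X| + `|Y|.
  by rewrite -addrA lerDl addr_ge0.
elim: e => /=.
- by move=> a; exists `|a| => // *; rewrite expr0 mulr1.
- by exists 1 => // *; rewrite expr0 mulr1.
- by exists 1 => // *; rewrite expr0 mulr1.
- exists 1 => // *; rewrite expr1 mul1r -addrA addrCA lerDl.
  by rewrite addr_ge0.
- by exists 1 => // *; rewrite expr1 mul1r lerDr addr_ge0.
- move=> e1 [C1 C10 H1] e2 [C2 C20 H2]; exists (C1 + C2); first exact: addr_ge0.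
  move=> s c X Y s1 c1; rewrite (le_trans (ler_normD _ _))// mulrDl lerD//.
  + apply: le_trans (H1 _ _ _ _ s1 c1) _.
    by rewrite ler_wpM2l// ler_weXn2l// leq_maxl.
  + apply: le_trans (H2 _ _ _ _ s1 c1) _.
    by rewrite ler_wpM2l// ler_weXn2l// leq_maxr.
- move=> e1 [C1 C10 H1] e2 [C2 C20 H2]; exists (C1 * C2); first exact: mulr_ge0.
  move=> s c X Y s1 c1; rewrite normrM exprD mulrACA.
  by rewrite ler_pM// ?H1 ?H2.
Qed.

Lemma is_derive_pev e (s c a a' b b' x : R) :
  is_derive x 1 (fun x => pev e s c (a * x + a') (b * x + b'))
    (a * pev (pdX e) s c (a * x + a') (b * x + b') +
     b * pev (pdY e) s c (a * x + a') (b * x + b')).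
Proof.
elim: e => /=.
- by move=> k; rewrite !mulr0 addr0; exact: is_derive_cst.
- by rewrite !mulr0 addr0; exact: is_derive_cst.
- by rewrite !mulr0 addr0; exact: is_derive_cst.
- by rewrite mulr1 mulr0 addr0; exact: is_derive_affine.
- by rewrite mulr1 mulr0 add0r; exact: is_derive_affine.
- by move=> e1 h1 e2 h2; have h := is_derive_add h1 h2; apply: is_derive_eq; ring.
- by move=> e1 h1 e2 h2; have h := is_derive_mul h1 h2; apply: is_derive_eq; ring.
Qed.

End pexp.

Section kernel1.
Context (R : realType).
Implicit Types (r c x z : R) (w : seq bool).

Definition psign (b : bool) (e : pexp R) : pexp R :=
  if b then PMul (PCst (-1)) e else e.

(* [kpol] and [qpol] are chosen so that the kernel [ker1] and its integral
   [int1] obey ker1 (b :: w) = (-1)^b d/dx ker1 w + x ker1 w, with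
   X = r x, Y = (z - c x) / r and s = r^2: each operator costs one factor 1/r. *)
Fixpoint kpol w : pexp R :=
  match w with
  | [::] => PCst 1
  | b :: w' => let P := kpol w' in
    PAdd (psign b
      (PAdd (PMul (PS R) (pdX P))
      (PAdd (PMul (PCst (-1)) (PMul (PC R) (pdY P)))
            (PMul (PAdd (PMul (PCst (-1)) (PMul (PS R) (PX R)))
                        (PMul (PC R) (PY R))) P))))
      (PMul (PX R) P)
  end.

(* The one-dimensional Mehler kernel at r = sqrt (tanh 2t), c = 1 / cosh 2t. *)
Definition gker r c x z : R :=
  Num.sqrt (c / (2 * pi)) / r * expR (- ((r * x) ^+ 2 + ((z - c * x) / r) ^+ 2) / 2).

Definition ker1 r c w x z : R :=
  r ^- size w * pev (kpol w) (r ^+ 2) c (r * x) ((z - c * x) / r) * gker r c x z.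

Lemma is_derive_gker r c x z : r != 0 -> is_derive x 1 (fun x => gker r c x z)
  ((- r ^+ 2 * x + c / r * ((z - c * x) / r)) * gker r c x z).
Proof.
move=> r0; rewrite /gker.
have h1 := is_derive_affine r 0 x.
have h2 := is_derive_affine (- (c / r)) (z / r) x.
have h3 := is_derive_scale (- 2^-1) (is_derive_add (is_derive_mul h1 h1) (is_derive_mul h2 h2)).
have h4 := is_derive_scale (Num.sqrt (c / (2 * pi)) / r) (is_derive_exp h3).
apply: is_derive_ext h4 => [y|].
  by congr (_ * expR _); field.
have -> : - 2^-1 * ((r * x + 0) * (r * x + 0) +
    (- (c / r) * x + z / r) * (- (c / r) * x + z / r)) =
    - ((r * x) ^+ 2 + ((z - c * x) / r) ^+ 2) / 2 by field.
by move: (expR _) (Num.sqrt _) => *; field.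
Qed.

Let exprVS r m : r ^- m.+1 = r^-1 * r ^- m.
Proof. by rewrite exprS invfM. Qed.

Lemma is_derive_ker1 r c w x z : r != 0 -> is_derive x 1 (fun x => ker1 r c w x z)
  ((ker1 r c (false :: w) x z - ker1 r c (true :: w) x z) / 2).
Proof.
move=> r0; rewrite /ker1 /= !exprVS.
have h1 := is_derive_pev (kpol w) (r ^+ 2) c r 0 (- (c / r)) (z / r) x.
have h2 := is_derive_scale (r ^- size w) (is_derive_mul h1 (is_derive_gker c x z r0)).
have eX y : r * y + 0 = r * y by rewrite addr0.
have eY y : - (c / r) * y + z / r = (z - c * y) / r by field.
apply: is_derive_ext h2 => [y|]; first by rewrite eX eY mulrA.
rewrite !eX !eY; move: (r ^- size w) (gker _ _ _ _) (pev _ _ _ _ _) (pev _ _ _ _ _) (pev _ _ _ _ _) => *.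
by field.
Qed.

Lemma mul_ker1 r c w x z : r != 0 ->
  x * ker1 r c w x z = (ker1 r c (false :: w) x z + ker1 r c (true :: w) x z) / 2.
Proof.
move=> r0; rewrite /ker1 /= !exprVS.
move: (r ^- size w) (gker _ _ _ _) (pev _ _ _ _ _) (pev _ _ _ _ _) (pev _ _ _ _ _) => *.
by field.
Qed.

(** Here [PX] stands for x itself and not for r x, and no power of r is taken out: a letter
    multiplies by x or differentiates, so it raises the degree in x by at most one. *)
Fixpoint qpol w : pexp R :=
  match w with
  | [::] => PCst 1
  | b :: w' => let P := qpol w' in
    PAdd (psign b (PAdd (pdX P) (PMul (PMul (PCst (-1)) (PMul (PS R) (PX R))) P)))
         (PMul (PX R) P)
  end.

Lemma pdeg_qpol w : (pdeg (qpol w) <= size w)%N.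
Proof.
elim: w => //= b w IH.
have h : (maxn (pdeg (pdX (qpol w))) (1 + pdeg (qpol w)) <= (size w).+1)%N.
  by rewrite geq_max add1n ltnS IH (leq_trans (pdeg_dX _))// (leq_trans IH).
by rewrite geq_max !add1n ltnS IH andbT; case: b.
Qed.

(** The integral of [gker r c x] over z. *)
Definition gint1 r c x : R := Num.sqrt c * expR (- (r * x) ^+ 2 / 2).

Definition int1 r c w x : R := pev (qpol w) (r ^+ 2) c x 0 * gint1 r c x.

Lemma is_derive_int1 r c w x : is_derive x 1 (fun x => int1 r c w x)
  ((int1 r c (false :: w) x - int1 r c (true :: w) x) / 2).
Proof.
rewrite /int1 /=.
have h1 := is_derive_pev (qpol w) (r ^+ 2) c 1 0 0 0 x.
have h2 := is_derive_affine r 0 x.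
have h3 := is_derive_scale (- 2^-1) (is_derive_mul h2 h2).
have h4 := is_derive_scale (Num.sqrt c) (is_derive_exp h3).
apply: is_derive_ext (is_derive_mul h1 h4) => [y|]; rewrite /gint1 !(mul1r, mul0r, addr0).
  by congr (_ * (_ * expR _)); field.
have -> : - 2^-1 * (r * x * (r * x)) = - (r * x) ^+ 2 / 2 by field.
by move: (expR _) (Num.sqrt c) (pev _ _ _ _ _) (pev _ _ _ _ _) => *; field.
Qed.

Lemma mul_int1 r c w x :
  x * int1 r c w x = (int1 r c (false :: w) x + int1 r c (true :: w) x) / 2.
Proof.
rewrite /int1 /=.
by move: (gint1 _ _ _) (pev _ _ _ _ _) (pev _ _ _ _ _) => *; field.
Qed.

Lemma expr_le_expR (d : nat) (v : R) : 0 <= v -> v ^+ d <= d`!%:R * expR v.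
Proof.
case: d => [|d] v0; first by rewrite expr0 mul1r -expR0 ler_expR.
have := expR_ge1Dxn d v0; rewrite -(@ler_pM2l _ (d.+1)`!%:R) ?ltr0n ?fact_gt0//.
apply: le_trans; rewrite mulrDr mulrCA divff ?mulr1 ?lerDr ?mulr_ge0//.
Qed.

(** Since |X| <= 1 + X^2 / 4, and likewise for Y, 1 + |X| + |Y| is at most 3 + (X^2 + Y^2) / 4; one
    term of the exponential series does the rest. *)
Lemma expr_le_gauss (d : nat) (X Y : R) :
  (1 + `|X| + `|Y|) ^+ d <= d`!%:R * expR 3 * expR ((X ^+ 2 + Y ^+ 2) / 4).
Proof.
apply: le_trans (expr_le_expR _ _) _; first by rewrite !addr_ge0.
rewrite -mulrA ler_wpM2l// -expRD ler_expR -(real_normK (num_real X)) -(real_normK (num_real Y)).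
have := sqr_ge0 (`|X| - 2); have := sqr_ge0 (`|Y| - 2); nra.
Qed.

(* Half of the Gaussian exponent is given up to absorb the polynomial factors. *)
Definition gker4 r c x z : R :=
  Num.sqrt (c / (2 * pi)) / r * expR (- ((r * x) ^+ 2 + ((z - c * x) / r) ^+ 2) / 4).

Lemma ker1_bound w : exists2 C : R, 0 <= C & forall r c x z : R,
  0 < r <= 1 -> 0 < c <= 1 ->
  (1 + `|r * x| + `|(z - c * x) / r|) * `|ker1 r c w x z| <=
  C * r ^- size w * gker4 r c x z.
Proof.
have [C C0 H] := pev_bound (kpol w).
set d := (pdeg (kpol w)).+1.
exists (C * (d`!%:R * expR 3)); first by rewrite !mulr_ge0 ?expR_ge0.
move=> r c x z /andP[r0 r1] /andP[c0 c1].
set X := r * x; set Y := (z - c * x) / r.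
have r2 : `|r ^+ 2| <= 1 by rewrite ger0_norm ?exprn_ge0 ?exprn_ile1// ltW.
have c2 : `|c| <= 1 by rewrite ger0_norm// ltW.
have g0 : 0 <= gker r c x z.
  by rewrite /gker !mulr_ge0 ?expR_ge0 ?sqrtr_ge0 ?invr_ge0 ?ltW.
have rw0 : 0 <= r ^- size w by rewrite invr_ge0 exprn_ge0// ltW.
have -> : `|ker1 r c w x z| =
    r ^- size w * `|pev (kpol w) (r ^+ 2) c X Y| * gker r c x z.
  by rewrite /ker1 2!normrM (ger0_norm g0) (ger0_norm rw0).
have -> : gker r c x z = gker4 r c x z * expR (- ((X ^+ 2 + Y ^+ 2) / 4)).
  rewrite /gker /gker4 -[RHS]mulrA -expRD; congr (_ * expR _).
  by rewrite /X /Y; field; rewrite gt_eqF.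
have g4 : 0 <= gker4 r c x z.
  by rewrite /gker4 !mulr_ge0 ?expR_ge0 ?sqrtr_ge0 ?invr_ge0 ?ltW.
have := H (r ^+ 2) c X Y r2 c2; set P := `|pev _ _ _ _ _| => HP.
have h := expr_le_gauss d X Y.
set T := 1 + `|X| + `|Y| in HP h *.
have T0 : 0 <= T by rewrite /T !addr_ge0.
set e := expR (- _).
have e0 : 0 <= e by exact: expR_ge0.
have he : expR ((X ^+ 2 + Y ^+ 2) / 4) * e = 1 by rewrite /e expRxMexpNx_1.
have key : T * P * e <= C * (d`!%:R * expR 3).
  apply: (@le_trans _ _ (C * T ^+ d * e)).
    by rewrite ler_wpM2r// exprS mulrCA ler_wpM2l.
  rewrite -mulrA ler_wpM2l//.
  apply: (@le_trans _ _ (d`!%:R * expR 3 * expR ((X ^+ 2 + Y ^+ 2) / 4) * e)).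
    by rewrite ler_wpM2r.
  by rewrite -mulrA he mulr1.
have -> : T * (r ^- size w * P * (gker4 r c x z * e)) =
  (T * P * e) * (r ^- size w * gker4 r c x z) by ring.
by rewrite -[leRHS]mulrA ler_wpM2r// mulr_ge0.
Qed.

End kernel1.

(** * From one variable to n: products over the coordinates *)

Section words.
Context (R : realType) (n : nat).
Implicit Types (x z : 'rV[R]_n) (w : seq (hindex n)).

(** On a product of functions of one coordinate each, letters of distinct indices act on distinct
    factors, so only the order among letters of the same index matters. *)
Definition subw w (k : 'I_n) : seq bool := [seq i.1 | i <- w & i.2 == k].

Lemma subw_cons b k w : subw ((b, k) :: w) k = b :: subw w k.
Proof. by rewrite /subw /= eqxx. Qed.

Lemma subw_consN b k w j : j != k -> subw ((b, k) :: w) j = subw w j.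
Proof. by rewrite /subw /= eq_sym => /negbTE ->. Qed.

Lemma sum_size_subw w : (\sum_k size (subw w k) = size w)%N.
Proof.
elim: w => [|[b k] w IH]; first by rewrite big1.
rewrite (bigD1 k)//= subw_cons /= -IH [in RHS](bigD1 k)//= addSn.
by congr (_ + _).+1; apply: eq_bigr => j jk; rewrite subw_consN.
Qed.

Lemma prod_expr_subw (a : R) w : \prod_k a ^+ size (subw w k) = a ^+ size w.
Proof. by rewrite -sum_size_subw expr_sum. Qed.

Definition upd x (k : 'I_n) (y : R) : 'rV[R]_n :=
  \row_j (if j == k then y else x 0 j).

Lemma updE x k y j : upd x k y 0 j = if j == k then y else x 0 j.
Proof. by rewrite mxE. Qed.

Lemma upd_id x k : upd x k (x 0 k) = x.
Proof. by apply/rowP => j; rewrite mxE; case: eqP => // ->. Qed.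

Lemma tuple_rV_upd (t : n.-tuple (measurableTypeR R)) k y :
  tuple_rV (tupd t k y) = upd (tuple_rV t) k y.
Proof. by apply/rowP => j; rewrite !mxE tnth_tupd. Qed.

Section product.
Variable F : 'I_n -> seq bool -> R -> R.

(** Common form of [kern] and [intn]: F k v is the k-th factor after the one-dimensional word v. A
    letter then changes a single factor, so the one-dimensional identities lift to n variables. *)
Definition prodF w x : R := \prod_k F k (subw w k) (x 0 k).

Lemma prodF_upd w x k y : prodF w (upd x k y) =
  F k (subw w k) y * \prod_(j | j != k) F j (subw w j) (x 0 j).
Proof.
rewrite /prodF (bigD1 k)//= updE eqxx; congr (_ * _).
by apply: eq_bigr => j /negbTE jk; rewrite updE jk.
Qed.

Lemma prodF_cons_upd b w x k y : prodF ((b, k) :: w) (upd x k y) =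
  F k (b :: subw w k) y * \prod_(j | j != k) F j (subw w j) (x 0 j).
Proof.
rewrite prodF_upd subw_cons; congr (_ * _).
by apply: eq_bigr => j jk; rewrite subw_consN.
Qed.

Lemma is_derive_prodF w x k (y : R) :
  (forall k v (y : R), is_derive y 1 (F k v)
    ((F k (false :: v) y - F k (true :: v) y) / 2)) ->
  is_derive y 1 (fun y => prodF w (upd x k y))
  ((prodF ((false, k) :: w) (upd x k y) - prodF ((true, k) :: w) (upd x k y)) / 2).
Proof.
move=> dF; rewrite !prodF_cons_upd.
have h := is_derive_scale (\prod_(j | j != k) F j (subw w j) (x 0 j)) (dF k (subw w k) y).
apply: is_derive_ext h => [y'|]; first by rewrite prodF_upd mulrC.
by field.
Qed.

Lemma mul_prodF w x k :
  (forall k v y, y * F k v y = (F k (false :: v) y + F k (true :: v) y) / 2) ->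
  x 0 k * prodF w x = (prodF ((false, k) :: w) x + prodF ((true, k) :: w) x) / 2.
Proof.
move=> hF; rewrite -[in RHS](upd_id x k) !prodF_cons_upd -{2}(upd_id x k) prodF_upd.
by rewrite mulrA hF; field.
Qed.

End product.

(* The word w acts on each coordinate through its subword. *)
Definition kern r c w x z : R := prodF (fun k v y => ker1 r c v y (z 0 k)) w x.
Definition intn r c w x : R := prodF (fun=> int1 r c) w x.
Definition kern4 r c x z : R := \prod_k gker4 r c (x 0 k) (z 0 k).

Lemma gker4_ge0 (r c x z : R) : 0 < r -> 0 <= gker4 r c x z.
Proof. by move=> r0; rewrite /gker4 !mulr_ge0 ?expR_ge0 ?sqrtr_ge0 ?invr_ge0 ?ltW. Qed.

Lemma kern_bound w : exists2 C : R, 0 <= C & forall (r c : R) x z,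
  0 < r <= 1 -> 0 < c <= 1 ->
  (\prod_k (1 + `|r * x 0 k| + `|(z 0 k - c * x 0 k) / r|)) * `|kern r c w x z|
  <= C * r ^- size w * kern4 r c x z.
Proof.
have /choice[CC HC] : forall k, exists C : R, 0 <= C /\ forall r c x z : R,
  0 < r <= 1 -> 0 < c <= 1 ->
  (1 + `|r * x| + `|(z - c * x) / r|) * `|ker1 r c (subw w k) x z| <=
  C * r ^- size (subw w k) * gker4 r c x z.
  by move=> k; have [C C0 H] := ker1_bound R (subw w k); exists C.
exists (\prod_k CC k); first by rewrite prodr_ge0// => k _; case: (HC k).
move=> r c x z r01 c01; have /andP[r0 _] := r01.
rewrite /kern /prodF normr_prod -big_split/= -exprVn -prod_expr_subw -!big_split/=.
apply: ler_prod => k _; rewrite mulr_ge0 ?addr_ge0//= exprVn.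
by case: (HC k) => _; exact.
Qed.

Lemma kern_bound1 w : exists2 C : R, 0 <= C & forall (r c : R) x z,
  0 < r <= 1 -> 0 < c <= 1 -> `|kern r c w x z| <= C * r ^- size w * kern4 r c x z.
Proof.
have [C C0 H] := kern_bound w; exists C => // r c x z r01 c01.
apply: le_trans (H r c x z r01 c01); rewrite ler_peMl//.
apply: (big_ind (fun a : R => 1 <= a)) => //; first exact: mulr_ege1.
by move=> k _; rewrite -addrA lerDl addr_ge0.
Qed.

End words.

Section measurability.
Context (R : realType) d (T : measurableType d).
Implicit Types (r c X Y x z : T -> R).

Lemma measurable_inv r : measurable_fun setT r -> (forall p, 0 <= r p) ->
  measurable_fun setT (fun p => (r p)^-1).
Proof.
move=> mr r0; under eq_fun => p do rewrite -powR_inv1//.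
by apply: (@measurableT_comp _ _ _ _ _ _ ((@powR R)^~ (-1))) => //.
Qed.

Lemma measurable_sqrt r : measurable_fun setT r ->
  measurable_fun setT (fun p => Num.sqrt (r p)).
Proof.
move=> mr; apply: (@measurableT_comp _ _ _ _ _ _ (@Num.sqrt R)) => //.
apply: continuous_measurable_fun; exact: sqrt_continuous.
Qed.

Lemma measurable_pev e r c X Y : measurable_fun setT r -> measurable_fun setT c ->
  measurable_fun setT X -> measurable_fun setT Y ->
  measurable_fun setT (fun p => pev e (r p) (c p) (X p) (Y p)).
Proof.
move=> mr mc mX mY; elim: e => //= e1 h1 e2 h2.
  exact: measurable_funD.
exact: measurable_funM.
Qed.

Lemma measurable_ker1 w r c x z : measurable_fun setT r -> measurable_fun setT c ->
  measurable_fun setT x -> measurable_fun setT z -> (forall p, 0 <= r p) ->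
  measurable_fun setT (fun p => ker1 (r p) (c p) w (x p) (z p)).
Proof.
move=> mr mc mx mz r0.
have mrx : measurable_fun setT (fun p => r p * x p) by exact: measurable_funM.
have mV : measurable_fun setT (fun p => (r p)^-1) by exact: measurable_inv.
have mY : measurable_fun setT (fun p => (z p - c p * x p) / r p).
  by apply: measurable_funM => //; apply: measurable_funB => //; exact: measurable_funM.
apply: measurable_funM; [apply: measurable_funM|].
- under eq_fun do rewrite -exprVn; exact: measurable_funX.
- by apply: measurable_pev => //; exact: measurable_funX.
- apply: measurable_funM; [apply: measurable_funM => //|].
    by apply: measurable_sqrt; apply: measurable_funM.
  apply: measurableT_comp => //; apply: measurable_funM => //.
  apply: measurableT_comp => //; apply: measurable_funD; exact: measurable_funX.
Qed.

Lemma measurable_kern n w r c (x z : T -> 'rV[R]_n) :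
  measurable_fun setT r -> measurable_fun setT c ->
  (forall k, measurable_fun setT (fun p => x p 0 k)) ->
  (forall k, measurable_fun setT (fun p => z p 0 k)) -> (forall p, 0 <= r p) ->
  measurable_fun setT (fun p => kern (r p) (c p) w (x p) (z p)).
Proof.
by move=> *; apply: measurable_prod => k _; exact: measurable_ker1.
Qed.

End measurability.

(** * Gaussian integrals and majorants in one variable *)

Section gauss_kernels.
Context (R : realType).
Local Notation mR := (measurableTypeR R).
Local Notation leb := (@lebesgue_measure R).
Implicit Types (r c x y z : R).

Let A r c : R := Num.sqrt (c / (2 * pi)) / r.

Let gauss_form a b r c x (z : mR) : r != 0 -> b != 0 ->
  a * expR (- ((r * x) ^+ 2 + (((z : R) - c * x) / r) ^+ 2) / b) =
  a * expR (- (r * x) ^+ 2 / b) * expR (- ((z : R) - c * x) ^+ 2 / (b * r ^+ 2)).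
Proof.
move=> r0 b0; rewrite -mulrA -expRD; congr (_ * expR _).
by field; rewrite r0.
Qed.

Let gauss_form_integrable a b r c x : 0 < r -> 0 < b -> leb.-integrable setT (EFin \o
  (fun z : mR => a * expR (- ((r * x) ^+ 2 + (((z : R) - c * x) / r) ^+ 2) / b))).
Proof.
move=> r0 b0; under eq_fun do rewrite gauss_form ?gt_eqF//.
have /(gauss_integrable (c * x)) : 0 < b * r ^+ 2 by rewrite mulr_gt0// exprn_gt0.
by move/(integrableZl measurableT (a * expR (- (r * x) ^+ 2 / b))).
Qed.

Let gauss_form_Rintegral a b r c x : 0 < r -> 0 < b ->
  \int[leb]_z (a * expR (- ((r * x) ^+ 2 + (((z : R) - c * x) / r) ^+ 2) / b)) =
  a * expR (- (r * x) ^+ 2 / b) * Num.sqrt (b * r ^+ 2 * pi).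
Proof.
move=> r0 b0; under eq_Rintegral do rewrite gauss_form ?gt_eqF//.
have br0 : 0 < b * r ^+ 2 by rewrite mulr_gt0// exprn_gt0.
by rewrite RintegralZl ?gauss_Rintegral//; exact: gauss_integrable.
Qed.

Lemma gker4_integrable r c x : 0 < r ->
  leb.-integrable setT (EFin \o (fun z : mR => gker4 r c x z)).
Proof. by move=> r0; exact: gauss_form_integrable. Qed.

Lemma gker_integrable r c x : 0 < r ->
  leb.-integrable setT (EFin \o (fun z : mR => gker r c x z)).
Proof. by move=> r0; exact: gauss_form_integrable. Qed.

Let sqrtA b r c : 0 < r -> 0 < c -> 0 < b ->
  Num.sqrt (c / (2 * pi)) / r * Num.sqrt (b * r ^+ 2 * pi) = Num.sqrt (b / 2 * c).
Proof.
move=> r0 c0 b0; have p0 := @pi_gt0 R.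
have -> : b * r ^+ 2 * pi = r ^+ 2 * (b * pi) by ring.
rewrite [Num.sqrt (r ^+ 2 * _)]sqrtrM ?sqr_ge0// sqrtr_sqr gtr0_norm// mulrA divfK ?gt_eqF//.
rewrite -sqrtrM; last by rewrite divr_ge0 ?mulr_ge0 ?ltW.
congr (Num.sqrt _); rewrite invfM [b * pi]mulrC mulrA [c * _]mulrA divfK ?gt_eqF//.
by field.
Qed.

Lemma gker4_Rintegral r c x : 0 < r -> 0 < c ->
  \int[leb]_z gker4 r c x z = Num.sqrt (2 * c) * expR (- (r * x) ^+ 2 / 4).
Proof.
move=> r0 c0; rewrite gauss_form_Rintegral// mulrAC sqrtA//.
by congr (Num.sqrt _ * _); field.
Qed.

Lemma gker_Rintegral r c x : 0 < r -> 0 < c ->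
  \int[leb]_z gker r c x z = gint1 r c x.
Proof.
move=> r0 c0; rewrite gauss_form_Rintegral// mulrAC sqrtA//.
by rewrite /gint1 divff// mul1r.
Qed.

(* A majorant of [gker4 r c y z] uniform in |y - x| <= 1, for differentiation
   under the integral sign. *)
Definition gker8 r c x z : R :=
  A r c * expR (1 / (4 * r ^+ 2)) * expR (- (z - c * x) ^+ 2 / (8 * r ^+ 2)).

Lemma gker8_ge0 r c x z : 0 < r -> 0 <= gker8 r c x z.
Proof.
by move=> r0; rewrite /gker8 /A !mulr_ge0 ?expR_ge0 ?sqrtr_ge0 ?invr_ge0 ?ltW.
Qed.

Lemma gker8_integrable r c x : 0 < r ->
  leb.-integrable setT (EFin \o (fun z : mR => gker8 r c x z)).
Proof.
move=> r0; have /(gauss_integrable (c * x)) : 0 < 8 * r ^+ 2 by rewrite mulr_gt0// exprn_gt0.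
by move/(integrableZl measurableT (A r c * expR (1 / (4 * r ^+ 2)))).
Qed.

(** As |c (y - x)| <= 1, one has (z - c x)^2 <= 2 (z - c y)^2 + 2. Division by 8 r^2 yields both the
    halved exponent and the constant exp(1 / (4 r^2)). *)
Lemma gker4_le8 r c x y z : 0 < r -> 0 < c <= 1 -> `|y - x| <= 1 ->
  gker4 r c y z <= gker8 r c x z.
Proof.
move=> r0 /andP[c0 c1] yx; rewrite /gker4 /gker8 -/(A r c) -mulrA ler_wpM2l//.
  by rewrite /A mulr_ge0 ?sqrtr_ge0 ?invr_ge0 ?ltW.
rewrite -expRD ler_expR -subr_ge0.
have r2 : 0 < r ^+ 2 by rewrite exprn_gt0.
have -> : 1 / (4 * r ^+ 2) + - (z - c * x) ^+ 2 / (8 * r ^+ 2) -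
  - ((r * y) ^+ 2 + ((z - c * y) / r) ^+ 2) / 4 =
  (8 * r ^+ 2)^-1 * (2 - (z - c * x) ^+ 2 + 2 * (z - c * y) ^+ 2 + 2 * (r ^+ 2) * (r * y) ^+ 2).
  by field; rewrite gt_eqF.
apply: mulr_ge0; first by rewrite invr_ge0 mulr_ge0// ltW.
apply: addr_ge0; last by rewrite mulr_ge0 ?sqr_ge0// mulr_ge0 ?ltW.
have h : (c * (y - x)) ^+ 2 <= 1.
  rewrite -real_normK ?num_real// normrM (gtr0_norm c0) exprn_ile1//.
    by rewrite mulr_ge0// ltW.
  by rewrite mulr_ile1// ltW.
have -> : z - c * y = (z - c * x) - c * (y - x) by ring.
have := sqr_ge0 ((z - c * x) - 2 * (c * (y - x))); nra.
Qed.

End gauss_kernels.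

Lemma half_sumdiff_inj (R : realFieldType) (a d a' d' : R) :
  (a - d) / 2 = (a' - d') / 2 -> (a' + d') / 2 = (a + d) / 2 ->
  a = a' /\ d = d'.
Proof. by split; lra. Qed.

(** * The operators W_w with free parameters r and c *)

Section kint.
Context (R : realType) (n : nat).
Local Notation mR := (measurableTypeR R).
Local Notation leb := (@lebesgue_measure R).
Local Notation L := (lebesgue_tuple R n).
Implicit Types (r c : R) (x z : 'rV[R]_n) (w : seq (hindex n)) (u : 'rV[R]_n -> R).

Definition kint r c w u x : R := integral_rV (fun z => kern r c w x z * u z).

Let prodE (f : R -> R -> R) x (t : n.-tuple mR) :
  \prod_k f (x 0 k) (tuple_rV t 0 k) = \prod_k f (x 0 k) (tnth t k).
Proof. by apply: eq_bigr => k _; rewrite tuple_rVE. Qed.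

Lemma kern4_integrable r c x : 0 < r ->
  L.-integrable setT (EFin \o (fun t => kern4 r c x (tuple_rV t))).
Proof.
move=> r0; under eq_fun do rewrite /kern4 (prodE (gker4 r c)).
apply: (@integrable_prod_tnth R n (fun k => gker4 r c (x 0 k))).
  by move=> k y; exact: gker4_ge0.
by move=> k; exact: gker4_integrable.
Qed.

Lemma kern8_integrable r c x : 0 < r ->
  L.-integrable setT (EFin \o (fun t => \prod_k gker8 r c (x 0 k) (tuple_rV t 0 k))).
Proof.
move=> r0; under eq_fun do rewrite (prodE (gker8 r c)).
apply: (@integrable_prod_tnth R n (fun k => gker8 r c (x 0 k))).
  by move=> k y; exact: gker8_ge0.
by move=> k; exact: gker8_integrable.
Qed.

Lemma kern4_Rintegral r c x : 0 < r -> 0 < c ->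
  \int[L]_t kern4 r c x (tuple_rV t) <= Num.sqrt (2 * c) ^+ n.
Proof.
move=> r0 c0; have -> : \int[L]_t kern4 r c x (tuple_rV t) = \int[L]_t \prod_k gker4 r c (x 0 k) (tnth t k).
  by apply: eq_Rintegral => t _; rewrite /kern4 (prodE (gker4 r c)).
rewrite (@Rintegral_prod_tnth R n (fun k => gker4 r c (x 0 k))); last 2 first.
- by move=> k y; exact: gker4_ge0.
- by move=> k; exact: gker4_integrable.
rewrite -[X in _ ^+ X](card_ord n) -prodr_const; apply: ler_prod => k _.
rewrite gker4_Rintegral// mulr_ge0 ?sqrtr_ge0 ?expR_ge0//=.
by rewrite ler_piMr ?sqrtr_ge0// expR_le1 mulNr oppr_le0 mulr_ge0 ?sqr_ge0.
Qed.

Lemma kern_nil_Rintegral r c x : 0 < r -> 0 < c ->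
  integral_rV (kern r c [::] x) = intn r c [::] x.
Proof.
move=> r0 c0; have g0 (y z : R) : 0 <= gker r c y z.
  by rewrite /gker !mulr_ge0 ?expR_ge0 ?sqrtr_ge0 ?invr_ge0 ?ltW.
have -> : integral_rV (kern r c [::] x) = \int[L]_t \prod_k gker r c (x 0 k) (tnth t k).
  apply: eq_Rintegral => t _; rewrite -(prodE (gker r c)); apply: eq_bigr => k _.
  by rewrite /ker1/= expr0 invr1 !mul1r.
rewrite (@Rintegral_prod_tnth R n (fun k => gker r c (x 0 k))); last 2 first.
- by move=> k y; exact: g0.
- by move=> k; exact: gker_integrable.
by apply: eq_bigr => k _; rewrite gker_Rintegral// /int1/= mul1r.
Qed.

Lemma measurable_kern_z r c w x : 0 <= r ->
  measurable_fun setT (fun t : n.-tuple mR => kern r c w x (tuple_rV t)).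
Proof.
move=> r0; apply: measurable_kern => // k.
under eq_fun do rewrite tuple_rVE; exact: measurable_tnth.
Qed.

(** The crude bound, through the supremum of u only: it lacks the gain r^alpha, but it covers the
    empty word and gives integrability for fixed r and c. *)
Lemma kint_bound0 w : exists2 C : R, 0 <= C & forall r c u M x,
  measurable_fun setT (u \o @tuple_rV R n) -> (forall z, `|u z| <= M) ->
  0 < r <= 1 -> 0 < c <= 1 ->
  `|kint r c w u x| <= C * M * r ^- size w * Num.sqrt (2 * c) ^+ n.
Proof.
have [C C0 H] := kern_bound1 R w; exists C => // r c u M x mu uM r01 c01.
have /andP[r0 _] := r01; have /andP[c0 _] := c01.
have M0 : 0 <= M by exact: le_trans (uM 0).
have rw0 : 0 <= r ^- size w by rewrite invr_ge0 exprn_ge0// ltW.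
apply: (@le_trans _ _ (\int[L]_t (C * M * r ^- size w * kern4 r c x (tuple_rV t)))).
  apply: Rintegral_dom => //.
  - by apply: measurable_funM => //; apply: measurable_kern_z; exact: ltW.
  - exact: (integrableZl measurableT _ (kern4_integrable c x r0)).
  - move=> t _; rewrite normrM.
    have -> : C * M * r ^- size w * kern4 r c x (tuple_rV t) =
      (C * r ^- size w * kern4 r c x (tuple_rV t)) * M by ring.
    by rewrite ler_pM// H.
rewrite RintegralZl//; last exact: kern4_integrable.
by rewrite ler_wpM2l ?kern4_Rintegral// !mulr_ge0.
Qed.

Section bounded.
Variables (u : 'rV[R]_n -> R) (M : R).
Hypothesis mu : measurable_fun setT (u \o @tuple_rV R n).
Hypothesis uM : forall z, `|u z| <= M.

Lemma M_ge0 : 0 <= M. Proof. exact: le_trans (uM 0). Qed.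

Lemma kint_integrable r c w x : 0 < r <= 1 -> 0 < c <= 1 ->
  L.-integrable setT (EFin \o (fun t => kern r c w x (tuple_rV t) * u (tuple_rV t))).
Proof.
move=> r01 c01; have [C C0 H] := kern_bound1 R w.
have /andP[r0 _] := r01.
apply: (@integrable_dom _ _ _ _ _ _ (fun t => C * r ^- size w * M * kern4 r c x (tuple_rV t))) => //.
- by apply: measurable_funM => //; apply: measurable_kern_z; exact: ltW.
- exact: (integrableZl measurableT _ (kern4_integrable c x r0)).
- move=> t _; rewrite normrM mulrAC ler_pM//; exact: H.
Qed.

Lemma kint_mul r c w x k : 0 < r <= 1 -> 0 < c <= 1 ->
  x 0 k * kint r c w u x =
  (kint r c ((false, k) :: w) u x + kint r c ((true, k) :: w) u x) / 2.
Proof.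
move=> r01 c01; have /andP[r0 _] := r01.
rewrite /kint /integral_rV -RintegralZl//; last exact: kint_integrable.
rewrite -RintegralD//; [|exact: kint_integrable..].
rewrite -RintegralZr//.
  apply: eq_Rintegral => t _; rewrite mulrA /kern mul_prodF.
    by field.
  by move=> j v y; rewrite mul_ker1// gt_eqF.
have := integrableD measurableT (kint_integrable ((false, k) :: w) x r01 c01)
  (kint_integrable ((true, k) :: w) x r01 c01).
by apply: eq_integrable.
Qed.

Lemma is_derive_kint r c w x k (y : R) : 0 < r <= 1 -> 0 < c <= 1 ->
  is_derive y 1 (fun y => kint r c w u (upd x k y))
  ((kint r c ((false, k) :: w) u (upd x k y) -
    kint r c ((true, k) :: w) u (upd x k y)) / 2).
Proof.
move=> r01 c01; have /andP[r0 _] := r01.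
have rN0 : r != 0 by rewrite gt_eqF.
pose f (y : R) (t : n.-tuple mR) := kern r c w (upd x k y) (tuple_rV t) * u (tuple_rV t).
pose df (y : R) (t : n.-tuple mR) :=
  (kern r c ((false, k) :: w) (upd x k y) (tuple_rV t) -
   kern r c ((true, k) :: w) (upd x k y) (tuple_rV t)) / 2 * u (tuple_rV t).
have dfE (y' : R) t : is_derive y' 1 (f ^~ t) (df y' t).
  have h := @is_derive_prodF R n (fun k v y => ker1 r c v y (tuple_rV t 0 k)) w x k y'
    (fun k v y => is_derive_ker1 c v y (tuple_rV t 0 k) rN0).
  apply: is_derive_ext (is_derive_scale (u (tuple_rV t)) h) => [y''|].
    by rewrite mulrC.
  by rewrite mulrC.
have d1E (y' : R) t : partial1of2 f y' t = df y' t.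
  by rewrite /partial1of2 derive1E; exact: (@derive_val _ _ _ _ _ _ _ (dfE y' t)).
have [C1 C10 H1] := kern_bound1 R ((false, k) :: w).
have [C2 C20 H2] := kern_bound1 R ((true, k) :: w).
pose x0 := upd x k y.
(* A majorant of the derivative for all y' within distance 1 of y: its Gaussians are centred by the
   fixed point [x0]. *)
pose G t := (C1 + C2) * r ^- (size w).+1 / 2 * M * \prod_j gker8 r c (x0 0 j) (tuple_rV t 0 j).
have k48 (y' : R) z : `|y' - y| <= 1 ->
    kern4 r c (upd x k y') z <= \prod_j gker8 r c (x0 0 j) (z 0 j).
  move=> yy; apply: ler_prod => j _; rewrite gker4_ge0//=; apply: gker4_le8 => //.
  by rewrite !updE; case: ifP => // _; rewrite subrr normr0.
have rw0 : 0 <= r ^- (size w).+1 by rewrite invr_ge0 exprn_ge0// ltW.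
have G0 t : 0 <= G t.
  rewrite /G !mulr_ge0 ?addr_ge0 ?M_ge0//.
  by rewrite prodr_ge0// => j _; exact: gker8_ge0.
have Iy : `](y - 1), (y + 1)[%classic y by rewrite /= in_itv/=; lra.
have intf (y' : R) : `](y - 1), (y + 1)[%classic y' -> L.-integrable setT (EFin \o f y').
  by move=> _; exact: kint_integrable.
have derf (y' : R) t : `](y - 1), (y + 1)[%classic y' -> setT t -> derivable (f ^~ t) y' 1.
  by move=> _ _; exact: (@ex_derive _ _ _ _ _ _ _ (dfE y' t)).
have iG : L.-integrable setT (EFin \o G).
  exact: (integrableZl measurableT _ (kern8_integrable c x0 r0)).
have Gub (y' : R) t : `](y - 1), (y + 1)[%classic y' -> setT t -> `|partial1of2 f y' t| <= G t.
  move=> /=; rewrite in_itv/= => yI _; rewrite d1E /df /G normrM.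
  have yy : `|y' - y| <= 1 by rewrite ler_norml; lra.
  set P := \prod_j _.
  have P0 : 0 <= P by rewrite prodr_ge0// => j _; exact: gker8_ge0.
  have -> : (C1 + C2) / r ^+ (size w).+1 / 2 * M * P =
    ((C1 + C2) * r ^- (size w).+1 * P / 2) * M by ring.
  rewrite ler_pM// normrM (@ger0_norm _ 2^-1) ?invr_ge0// ler_wpM2r ?invr_ge0//.
  apply: le_trans (ler_normB _ _) _; rewrite !mulrDl lerD//.
    apply: le_trans (H1 _ _ _ _ r01 c01) _; apply: ler_wpM2l; last exact: k48.
    by rewrite mulr_ge0.
  apply: le_trans (H2 _ _ _ _ r01 c01) _; apply: ler_wpM2l; last exact: k48.
  by rewrite mulr_ge0.
have D := derivable_under_integral measurableT Iy intf derf G0 iG Gub.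
have V := differentiation_under_integral measurableT Iy intf derf G0 iG Gub.
rewrite derive1E in V.
have := DeriveDef D V; apply: is_derive_ext => //.
transitivity (\int[L]_t df y t).
  by apply: eq_Rintegral => t _; rewrite d1E.
rewrite /kint /integral_rV -RintegralB//; [|exact: kint_integrable..].
rewrite -RintegralZr//.
  by apply: eq_Rintegral => t _; rewrite /df; field.
have := integrableB measurableT (kint_integrable ((false, k) :: w) (upd x k y) r01 c01)
  (kint_integrable ((true, k) :: w) (upd x k y) r01 c01).
by apply: eq_integrable.
Qed.

End bounded.

(* Both sides satisfy the same recursion in w, as the half-sum and half-difference
   of the two extensions of w by a letter of index k are forced. *)
Lemma kint1 r c w x : 0 < r <= 1 -> 0 < c <= 1 ->
  kint r c w (fun=> 1) x = intn r c w x.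
Proof.
move=> r01 c01; have /andP[r0 _] := r01; have /andP[c0 _] := c01.
have m1 : measurable_fun setT ((fun=> 1 : R) \o @tuple_rV R n) by exact: measurable_cst.
have n1 (z : 'rV[R]_n) : `|1 : R| <= 1 by rewrite normr1.
elim: w x => [|[b k] w IH] x.
  rewrite -kern_nil_Rintegral// /kint; congr integral_rV.
  by apply/funext => z; rewrite mulr1.
have hm := kint_mul m1 n1 w x k r01 c01.
have hm' : x 0 k * intn r c w x = (intn r c ((false, k) :: w) x + intn r c ((true, k) :: w) x) / 2.
  by apply: mul_prodF => j v y; exact: mul_int1.
have hd := is_derive_kint m1 n1 w x k (x 0 k) r01 c01.
(* By the induction hypothesis the function differentiated is also [intn r c w], so its derivative
   is known a second time; comparing the two gives the half-difference. *)
have hd' : is_derive (x 0 k) 1 (fun y => kint r c w (fun=> 1) (upd x k y))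
    ((intn r c ((false, k) :: w) x - intn r c ((true, k) :: w) x) / 2).
  have h := @is_derive_prodF R n (fun=> int1 r c) w x k (x 0 k)
    (fun k v y => is_derive_int1 r c v y).
  rewrite upd_id in h; apply: is_derive_ext h => // y; exact: IH.
have e1 := @derive_val _ _ _ _ _ _ _ hd.
have e2 := @derive_val _ _ _ _ _ _ _ hd'.
rewrite e1 upd_id in e2; rewrite IH hm' in hm.
by have [h1 h2] := half_sumdiff_inj e2 hm; case: b.
Qed.

End kint.

(** * The spatial bound *)

Section enorm.
Context (R : realType) (n : nat).
Implicit Types x y : 'rV[R]_n.

Lemma dotp_ge0 x : 0 <= dotp x x.
Proof. by apply: sumr_ge0 => k _; rewrite -expr2 sqr_ge0. Qed.

Lemma enorm_ge0 x : 0 <= enorm x. Proof. exact: sqrtr_ge0. Qed.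

Lemma enorm_sqr x : enorm x ^+ 2 = \sum_k x 0 k ^+ 2.
Proof. by rewrite sqr_sqrtr ?dotp_ge0//; apply: eq_bigr => k _; rewrite expr2. Qed.

Lemma coord_le_enorm x k : `|x 0 k| <= enorm x.
Proof.
rewrite -(@ler_pXn2r _ 2) ?nnegrE ?enorm_ge0// enorm_sqr real_normK ?num_real//.
by rewrite (bigD1 k)//= lerDl sumr_ge0// => j _; rewrite sqr_ge0.
Qed.

Lemma sum_sqr_le (I : Type) (s : seq I) (a : I -> R) : (forall i, 0 <= a i) ->
  \sum_(i <- s) a i ^+ 2 <= (\sum_(i <- s) a i) ^+ 2.
Proof.
move=> a0; elim: s => [|i s IH]; first by rewrite !big_nil expr2 mulr0.
rewrite !big_cons sqrrD -addrA lerD2l (le_trans IH)// lerDr mulrn_wge0//.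
by rewrite mulr_ge0// sumr_ge0.
Qed.

Lemma enorm_le_sum x : enorm x <= \sum_k `|x 0 k|.
Proof.
rewrite -(@ler_pXn2r _ 2) ?nnegrE ?enorm_ge0 ?sumr_ge0// enorm_sqr.
apply: le_trans (@sum_sqr_le _ _ (fun k => `|x 0 k|) _) => //.
by rewrite le_eqVlt; apply/orP; left; apply/eqP; apply: eq_bigr => k _;
  rewrite real_normK ?num_real.
Qed.

Lemma sum_le_prod1D (I : Type) (s : seq I) (a : I -> R) : (forall i, 0 <= a i) ->
  1 + \sum_(i <- s) a i <= \prod_(i <- s) (1 + a i).
Proof.
move=> a0; elim: s => [|i s IH]; first by rewrite !big_nil addr0.
rewrite !big_cons; apply: (@le_trans _ _ ((1 + a i) * (1 + \sum_(j <- s) a j))).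
  have := a0 i; have : 0 <= \sum_(j <- s) a j by rewrite sumr_ge0.
  nra.
by rewrite ler_wpM2l// addr_ge0.
Qed.

End enorm.

Section main_bound.
Context (R : realType) (n : nat) (alpha : R).
Hypotheses (alpha0 : 0 < alpha) (alpha1 : alpha < 1).
Local Notation mR := (measurableTypeR R).
Local Notation L := (lebesgue_tuple R n).
Implicit Types (r c : R) (x z : 'rV[R]_n) (w : seq (hindex n)) (u : 'rV[R]_n -> R).

(** One real M dominates both seminorms, and measurability replaces continuity: this is the form in
    which the integral estimates use membership in the space. *)
Record CH_bound u (M : R) : Prop := CHBound {
  CHb_meas : measurable_fun setT (u \o @tuple_rV R n) ;
  CHb_holder : forall x y, `|u x - u y| <= M * enorm (x - y) `^ alpha ;
  CHb_growth : forall x, (1 + enorm x) `^ alpha * `|u x| <= M }.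

Lemma CHb_sup u M : CH_bound u M -> forall x, `|u x| <= M.
Proof.
move=> [_ _ H] x; apply: le_trans (H x).
have h1 : 1 <= 1 + enorm x by rewrite lerDl enorm_ge0.
by rewrite ler_peMl// -[leLHS](powRr0 (1 + enorm x)) ler_powR// ltW.
Qed.

Lemma CHb_ge0 u M : CH_bound u M -> 0 <= M.
Proof. by move=> H; exact: le_trans (CHb_sup H 0). Qed.

(** The polynomial degree in coordinate k is at most the length of the k-th subword, these lengths
    add up to |w|, and the Gaussians multiply to one in |x|. *)
Lemma intn_bound w : exists2 C : R, 0 <= C & forall r c x, 0 < r <= 1 -> 0 < c <= 1 ->
  `|intn r c w x| <= C * (1 + enorm x) ^+ size w *
    (Num.sqrt c ^+ n * expR (- (r * enorm x) ^+ 2 / 2)).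
Proof.
have /choice[CC HC] : forall k, exists C : R, 0 <= C /\ forall r c y : R,
    0 < r <= 1 -> 0 < c <= 1 ->
    `|int1 r c (subw w k) y| <= C * (1 + `|y|) ^+ size (subw w k) * gint1 r c y.
  move=> k; have [C C0 H] := pev_bound (qpol R (subw w k)); exists C; split => //.
  move=> r c y /andP[r0 r1] /andP[c0 c1]; rewrite /int1 normrM.
  have g0 : 0 <= gint1 r c y by rewrite mulr_ge0 ?sqrtr_ge0 ?expR_ge0.
  rewrite (ger0_norm g0) ler_wpM2r//.
  apply: le_trans (H _ _ _ _ _ _) _.
  - by rewrite ger0_norm ?exprn_ge0 ?exprn_ile1// ltW.
  - by rewrite ger0_norm// ltW.
  by rewrite normr0 addr0 ler_wpM2l// ler_weXn2l ?pdeg_qpol// lerDl.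
exists (\prod_k CC k); first by rewrite prodr_ge0// => k _; case: (HC k).
move=> r c x r01 c01.
have -> : Num.sqrt c ^+ n * expR (- (r * enorm x) ^+ 2 / 2) = \prod_k gint1 r c (x 0 k).
  rewrite /gint1 big_split/= prodr_const card_ord; congr (_ * _).
  rewrite -expR_sum; congr expR.
  rewrite exprMn enorm_sqr -mulr_suml sumrN mulr_sumr.
  by congr (- _ / _); apply: eq_bigr => k _; rewrite exprMn.
rewrite /intn /prodF normr_prod -prod_expr_subw -!big_split/=.
apply: ler_prod => k _; rewrite normr_ge0/=.
case: (HC k) => CC0 /(_ r c (x 0 k) r01 c01) h; apply: le_trans h _.
rewrite ler_wpM2r ?mulr_ge0 ?sqrtr_ge0 ?expR_ge0// ler_wpM2l// lerXn2r ?nnegrE ?addr_ge0 ?enorm_ge0//.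
by rewrite lerD2l coord_le_enorm.
Qed.

(** Multiply by r^(m - alpha): since r (1 + e) <= 1 + r e and 0 <= m - alpha <= m, the weight
    becomes at most (1 + r e)^m, which half of the Gaussian exponent absorbs. *)
Lemma gauss_weight (m : nat) r (e : R) : (0 < m)%N -> 0 < r <= 1 -> 0 <= e ->
  (1 + e) `^ (m%:R - alpha) * expR (- (r * e) ^+ 2 / 2) <=
  m`!%:R * expR 3 * r `^ (alpha - m%:R).
Proof.
move=> m0 /andP[r0 r1] e0.
have m1 : 1 <= m%:R :> R by rewrite ler1n.
have ma0 : 0 <= m%:R - alpha by rewrite subr_ge0 (le_trans (ltW alpha1)).
have -> : r `^ (alpha - m%:R) = (r `^ (m%:R - alpha))^-1 by rewrite -powRN opprB.
rewrite ler_pdivlMr ?powR_gt0// mulrAC -powRM ?addr_ge0 ?(ltW r0)//.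
have h1 : ((1 + e) * r) `^ (m%:R - alpha) <= (1 + r * e) `^ (m%:R - alpha).
  rewrite ge0_ler_powR// ?nnegrE ?addr_ge0 ?mulr_ge0 ?addr_ge0 ?(ltW r0)//.
  by rewrite mulrDl mul1r [e * r]mulrC lerD2r.
have h2 : (1 + r * e) `^ (m%:R - alpha) <= (1 + r * e) ^+ m.
  rewrite -powR_mulrn ?addr_ge0 ?mulr_ge0 ?(ltW r0)// ler_powR//.
    by rewrite lerDl mulr_ge0// ltW.
  by rewrite gerBl ltW.
have h3 := expr_le_gauss m (r * e) (0 : R).
rewrite normr0 addr0 expr0n/= addr0 ger0_norm in h3; last by rewrite mulr_ge0// ltW.
apply: (@le_trans _ _ (m`!%:R * expR 3 * expR ((r * e) ^+ 2 / 4) * expR (- (r * e) ^+ 2 / 2))).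
  by rewrite ler_wpM2r ?expR_ge0// (le_trans h1)// (le_trans h2).
rewrite -mulrA -expRD ler_piMr ?mulr_ge0 ?expR_ge0//.
by rewrite expR_le1; have := sqr_ge0 (r * e); lra.
Qed.

Lemma kint_bound w : (0 < size w)%N ->
  exists2 C : R, 0 <= C & forall r c u M x, 0 < r -> 0 < c ->
  c ^+ 2 + r ^+ 4 = 1 -> CH_bound u M ->
  `|kint r c w u x| <= C * M * r `^ (alpha - (size w)%:R) * Num.sqrt c ^+ n.
Proof.
move=> m0; have [C1 C10 H1] := kern_bound R w; have [C2 C20 H2] := intn_bound w.
exists (C1 * Num.sqrt 2 ^+ n + C2 * ((size w)`!%:R * expR 3)).
  by rewrite addr_ge0// !mulr_ge0// ?exprn_ge0 ?sqrtr_ge0 ?expR_ge0.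
move=> r c u M x r0 c0 cr uM.
have r1 : r <= 1 by rewrite -(@expr_le1 _ 4) ?(ltW r0)//; have := sqr_ge0 c; clear m0; lra.
have c1 : c <= 1 by rewrite -(@expr_le1 _ 2) ?(ltW c0)//; have := exprn_ge0 4 (ltW r0); clear m0; lra.
have r01 : 0 < r <= 1 by rewrite r0.
have c01 : 0 < c <= 1 by rewrite c0.
have M0 := CHb_ge0 uM; have mu := CHb_meas uM; have us := CHb_sup uM.
have m1 : measurable_fun setT ((fun=> 1 : R) \o @tuple_rV R n) by exact: measurable_cst.
have n1 (z : 'rV[R]_n) : `|1 : R| <= 1 by rewrite normr1.
have ra : r `^ (alpha - (size w)%:R) = r `^ alpha * r ^- size w.
  rewrite powRD ?powRN ?powR_mulrn ?(ltW r0)//.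
  by apply/implyP => _; rewrite gt_eqF.
have -> : kint r c w u x = integral_rV (fun z => kern r c w x z * (u z - u x)) + u x * intn r c w x.
  rewrite -kint1// /kint /integral_rV -(RintegralZl (u x) measurableT (kint_integrable m1 n1 w x r01 c01)).
  rewrite -RintegralD//.
  - by apply: eq_Rintegral => t _ /=; ring.
  - have := integrableB measurableT (kint_integrable mu us w x r01 c01)
      (integrableZl measurableT (u x) (kint_integrable m1 n1 w x r01 c01)).
    by apply: eq_integrable => // t _ /=; rewrite mulrBr mulr1 [u x * _]mulrC.
  - exact: (integrableZl measurableT (u x) (kint_integrable m1 n1 w x r01 c01)).
apply: le_trans (ler_normD _ _) _; rewrite !mulrDl lerD//.
  apply: (@le_trans _ _ (\int[L]_t (C1 * M * (r `^ alpha * r ^- size w) * kern4 r c x (tuple_rV t)))).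
    apply: Rintegral_dom => //.
    - apply: measurable_funM; first by apply: measurable_kern_z; exact: ltW.
      exact: measurable_funB.
    - exact: (integrableZl measurableT _ (kern4_integrable c x r0)).
    - move=> t _; move: (tuple_rV t) => z {t}; rewrite normrM.
      have := H1 r c x z r01 c01; set P := \prod_k _ => HP.
      have P1 : 1 + \sum_k (`|r * x 0 k| + `|(z 0 k - c * x 0 k) / r|) <= P.
        have := @sum_le_prod1D R _ (index_enum 'I_n) (fun k => `|r * x 0 k| + `|(z 0 k - c * x 0 k) / r|).
        move=> /(_ (fun k => addr_ge0 (normr_ge0 _) (normr_ge0 _))) h.
        by apply: le_trans h _; rewrite le_eqVlt; apply/orP; left; apply/eqP;
          apply: eq_bigr => k _; rewrite addrA.
      have S0 : 0 <= \sum_k (`|r * x 0 k| + `|(z 0 k - c * x 0 k) / r|).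
        by rewrite sumr_ge0// => k _; rewrite addr_ge0.
      have zx : enorm (z - x) <= r * P.
        apply: le_trans (enorm_le_sum _) _.
        apply: (@le_trans _ _ (r * \sum_k (`|r * x 0 k| + `|(z 0 k - c * x 0 k) / r|))); last first.
          by rewrite ler_wpM2l ?(ltW r0)//; clear m0 n1; lra.
        rewrite mulr_sumr; apply: ler_sum => k _; rewrite !mxE.
        have -> : z 0 k - x 0 k = (z 0 k - c * x 0 k) - (1 - c) * x 0 k by ring.
        apply: le_trans (ler_normB _ _) _; rewrite mulrDr addrC.
        apply: lerD.
          rewrite !normrM (gtr0_norm r0) (ger0_norm (_ : 0 <= 1 - c)) ?subr_ge0//.
          rewrite mulrA ler_wpM2r// -expr2.
          (* With c^2 <= c, this turns c^2 + r^4 = 1 into 1 - c <= r^2. *)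
          have : r ^+ 4 <= r ^+ 2 by rewrite ler_wiXn2l// ltW.
          have : c ^+ 2 <= c by rewrite expr2 ler_piMr// ltW.
          clear m0 n1; lra.
        by rewrite normrM normfV (gtr0_norm r0) mulrCA divff ?mulr1// gt_eqF.
      (* Since P >= 1, P^alpha <= P: the Hoelder increment uses exactly the one factor P reserved in
         [kern_bound]. *)
      have u1 : `|u z - u x| <= M * (r `^ alpha * P).
        apply: le_trans (CHb_holder uM z x) _; rewrite ler_wpM2l//.
        have P1' : 1 <= P by clear m0 n1; lra.
        apply: (@le_trans _ _ ((r * P) `^ alpha)).
          rewrite ge0_ler_powR ?nnegrE ?enorm_ge0 ?mulr_ge0 ?(ltW r0) ?(ltW alpha0)//; clear m0 n1; lra.
        rewrite powRM ?(ltW r0)//; last by clear m0 n1; lra.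
        by rewrite ler_wpM2l ?powR_ge0// ler1_powR// ltW.
      apply: (@le_trans _ _ (`|kern r c w x z| * (M * (r `^ alpha * P)))).
        by rewrite ler_wpM2l.
      have -> : `|kern r c w x z| * (M * (r `^ alpha * P)) =
        (P * `|kern r c w x z|) * (M * r `^ alpha) by ring.
      apply: (@le_trans _ _ (C1 * r ^- size w * kern4 r c x z * (M * r `^ alpha))).
        by rewrite ler_wpM2r// mulr_ge0// powR_ge0.
      by rewrite le_eqVlt; apply/orP; left; apply/eqP; ring.
  rewrite RintegralZl//; last exact: kern4_integrable.
  rewrite -ra.
  have h := @kern4_Rintegral R n r c x r0 c0.
  rewrite sqrtrM// exprMn in h.
  have -> : C1 * Num.sqrt 2 ^+ n * M * r `^ (alpha - (size w)%:R) * Num.sqrt c ^+ n =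
    C1 * M * r `^ (alpha - (size w)%:R) * (Num.sqrt 2 ^+ n * Num.sqrt c ^+ n) by ring.
  by rewrite ler_wpM2l// !mulr_ge0// powR_ge0.
(* The term u(x) times the total integral: the growth seminorm supplies (1 + |x|)^(-alpha), and the
   remaining weight is the one of [gauss_weight]. *)
rewrite normrM.
set E := expR (- (r * enorm x) ^+ 2 / 2).
have e0 := enorm_ge0 x.
have e1 : 0 < 1 + enorm x by clear m0 n1; lra.
have Hw := gauss_weight m0 r01 e0; rewrite -/E in Hw.
have ux : `|u x| <= M * (1 + enorm x) `^ (- alpha).
  by rewrite powRN ler_pdivlMr ?powR_gt0// mulrC; exact: CHb_growth.
apply: (@le_trans _ _ (M * (1 + enorm x) `^ (- alpha) *
   (C2 * (1 + enorm x) ^+ size w * (Num.sqrt c ^+ n * E)))).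
  by rewrite ler_pM// H2.
have -> : M * (1 + enorm x) `^ (- alpha) * (C2 * (1 + enorm x) ^+ size w * (Num.sqrt c ^+ n * E)) =
   C2 * M * Num.sqrt c ^+ n * ((1 + enorm x) `^ ((size w)%:R - alpha) * E).
  rewrite powRD ?powR_mulrn ?(ltW e1)//; first by ring.
  by apply/implyP => _; rewrite gt_eqF.
have -> : C2 * ((size w)`!%:R * expR 3) * M * r `^ (alpha - (size w)%:R) * Num.sqrt c ^+ n =
  C2 * M * Num.sqrt c ^+ n * ((size w)`!%:R * expR 3 * r `^ (alpha - (size w)%:R)) by ring.
by rewrite ler_wpM2l// !mulr_ge0// exprn_ge0// sqrtr_ge0.
Qed.

End main_bound.

(** * Time parametrization *)

(** For c = cosh 2t, s = sinh 2t and p = pi, the left side is the square of the normalization of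
    [gker], the right side that of the Mehler kernel in one variable. *)
Lemma mehler_constant (F : realFieldType) (c s p : F) : c != 0 -> s != 0 -> p != 0 ->
  c^-1 / (2 * p) * (s / c)^-1 = (2 * p * s)^-1.
Proof. by move=> c0 s0 p0; field; rewrite c0 s0 p0. Qed.

(* With D = cosh 2t, P = sinh 2t and T = tanh t, this completes the square in
   z - x / cosh 2t in the exponent of the Mehler kernel. *)
Lemma mehler_exponent (F : realFieldType) (D P T x z : F) : D != 0 -> P != 0 ->
  D * D = P * P + 1 -> T = (D - 1) / P ->
  - (2^-1 * ((x - z) * (x - z)) * (D / P) + x * z * T) =
  - (P / D * x ^+ 2 + (z - D^-1 * x) ^+ 2 / (P / D)) / 2.
Proof.
move=> D0 P0 hD ->.
have -> : P / D * x ^+ 2 + (z - D^-1 * x) ^+ 2 / (P / D) =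
  (P * P + 1) * x ^+ 2 / (D * P) - 2 * x * z / P + z ^+ 2 * D / P.
  by field; rewrite D0 P0.
by rewrite -hD; field; rewrite D0 P0.
Qed.

Section time.
Context (R : realType).
Implicit Types t : R.
Local Notation mR := (measurableTypeR R).

Definition rt t : R := Num.sqrt (tanh (2 * t)).
Definition ct t : R := (cosh (2 * t))^-1.

Lemma cosh_gt0 t : 0 < cosh t.
Proof. by rewrite /cosh divr_gt0// addr_gt0 ?expR_gt0. Qed.

Lemma sinh_gt0 t : 0 < t -> 0 < sinh t.
Proof. by move=> t0; rewrite /sinh divr_gt0// subr_gt0 ltr_expR; lra. Qed.

Lemma tanh_gt0 t : 0 < t -> 0 < tanh t.
Proof. by move=> t0; rewrite /tanh divr_gt0 ?sinh_gt0 ?cosh_gt0. Qed.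

Lemma cosh2Bsinh2 t : cosh t ^+ 2 - sinh t ^+ 2 = 1.
Proof.
have h := expRxMexpNx_1 t; rewrite /cosh /sinh.
have -> : ((expR t + expR (- t)) / 2) ^+ 2 - ((expR t - expR (- t)) / 2) ^+ 2 =
  expR t * expR (- t) by field.
exact: h.
Qed.

Lemma rt_ge0 t : 0 <= rt t. Proof. exact: sqrtr_ge0. Qed.

Lemma rt_gt0 t : 0 < t -> 0 < rt t.
Proof. by move=> t0; rewrite sqrtr_gt0 tanh_gt0// mulr_gt0. Qed.

Lemma rt2 t : 0 < t -> rt t ^+ 2 = tanh (2 * t).
Proof. by move=> t0; rewrite sqr_sqrtr// ltW// tanh_gt0// mulr_gt0. Qed.

Lemma ct_gt0 t : 0 < ct t. Proof. by rewrite invr_gt0 cosh_gt0. Qed.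

Lemma ct_rt t : 0 < t -> ct t ^+ 2 + rt t ^+ 4 = 1.
Proof.
move=> t0; rewrite (exprM _ 2 2) rt2// /tanh /ct.
have c0 := cosh_gt0 (2 * t); have h := cosh2Bsinh2 (2 * t).
have -> : (cosh (2 * t))^-1 ^+ 2 + (sinh (2 * t) / cosh (2 * t)) ^+ 2 =
  (1 + sinh (2 * t) ^+ 2) / cosh (2 * t) ^+ 2 by field; rewrite gt_eqF.
have -> : 1 + sinh (2 * t) ^+ 2 = cosh (2 * t) ^+ 2 by lra.
by rewrite divff// expf_neq0// gt_eqF.
Qed.

Lemma rt01 t : 0 < t -> 0 < rt t <= 1.
Proof.
move=> t0; rewrite rt_gt0//= -(@expr_le1 _ 4) ?rt_ge0//.
by have := ct_rt t0; have := sqr_ge0 (ct t); lra.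
Qed.

Lemma ct01 t : 0 < ct t <= 1.
Proof.
rewrite ct_gt0/= invf_le1 ?cosh_gt0// -(@ler_pXn2r _ 2) ?nnegrE ?(ltW (cosh_gt0 _))//.
by have := cosh2Bsinh2 (2 * t); have := sqr_ge0 (sinh (2 * t)); rewrite expr1n; lra.
Qed.

Lemma ct_le_exp t : ct t <= 2 * expR (- (2 * t)).
Proof.
have h := expRxMexpNx_1 (2 * t); have b0 := expR_gt0 (- (2 * t)).
rewrite /ct -[leLHS]mul1r ler_pdivrMr ?cosh_gt0// /cosh.
by move: (expR (2 * t)) (expR (- (2 * t))) h b0 => a b h b0; nra.
Qed.

Lemma tanh_ge_small t : 0 < t <= 1 -> expR (- 2) * t <= tanh (2 * t).
Proof.
move=> /andP[t0 t1]; rewrite /tanh ler_pdivlMr ?cosh_gt0//.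
have h1 : t <= sinh (2 * t).
  have := expR_ge1Dx (2 * t); have : expR (- (2 * t)) <= 1 by rewrite expR_le1; lra.
  rewrite /sinh; lra.
have h2 : cosh (2 * t) <= expR 2.
  rewrite /cosh; have : expR (2 * t) <= expR 2 by rewrite ler_expR; lra.
  have : expR (- (2 * t)) <= expR 2 by rewrite ler_expR; lra.
  lra.
apply: le_trans h1.
have -> : expR (- 2) * t * cosh (2 * t) = t * (cosh (2 * t) * expR (- 2)) by ring.
rewrite ler_piMr// ?(ltW t0)//.
by rewrite expRN ler_pdivrMr ?expR_gt0// mul1r.
Qed.

Lemma tanh_ge_large t : 1 <= t -> 2^-1 <= tanh (2 * t).
Proof.
move=> t1; rewrite /tanh ler_pdivlMr ?cosh_gt0// /sinh /cosh.
have h1 : expR 2 <= expR (2 * t) by rewrite ler_expR; lra.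
have h2 : expR (- (2 * t)) <= expR (- 2) by rewrite ler_expR; lra.
have h3 := expR_ge1Dx (2 : R).
have h4 : expR (- 2) <= 1 :> R by rewrite expR_le1; lra.
lra.
Qed.

Lemma powR_le_expR (d t : R) : 1 <= t -> t `^ d <= (Num.truncn `|d|).+1`!%:R * expR t.
Proof.
move=> t1; apply: le_trans (expr_le_expR _ _); last by lra.
rewrite -powR_mulrn; last by lra.
rewrite ler_powR// (le_trans (ler_norm d))// ltW//.
exact: truncnS_gt.
Qed.

(** For t <= 1, r^2 is at least a multiple of t, and t^(-g/2) <= t^(-d/2). For t >= 1, r is bounded
    below and sqrt c <= sqrt 2 e^(-t) beats every power of t. The constants [A] and [B] belong to
    these two ranges. *)
Lemma time_decay (g d : R) : 0 <= g -> g <= d ->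
  exists2 C : R, 0 <= C & forall t, 0 < t ->
  rt t `^ (- g) * Num.sqrt (ct t) <= C * t `^ (- (d / 2)).
Proof.
move=> g0 gd.
set A := (expR (- 2)) `^ (- (g / 2)).
set B := (2^-1) `^ (- (g / 2)) * (Num.sqrt 2 * (Num.truncn `|d / 2|).+1`!%:R).
have A0 : 0 <= A by exact: powR_ge0.
have B0 : 0 <= B by rewrite !mulr_ge0 ?powR_ge0 ?sqrtr_ge0.
have anti (a b e : R) : 0 < a -> a <= b -> 0 <= e -> b `^ (- e) <= a `^ (- e).
  move=> a0 ab e0; rewrite !powRN lef_pV2 ?posrE ?powR_gt0//; last exact: lt_le_trans ab.
  by rewrite ge0_ler_powR ?nnegrE ?(ltW a0)// (le_trans (ltW a0)).
have g2 : 0 <= g / 2 by rewrite divr_ge0.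
exists (A + B); first exact: addr_ge0.
move=> t t0; have /andP[c0 c1] := ct01 t.
have E : rt t `^ (- g) = tanh (2 * t) `^ (- (g / 2)).
  rewrite -rt2// -powR_mulrn ?rt_ge0// -powRrM; congr (_ `^ _); by field.
have sc1 : Num.sqrt (ct t) <= 1 by rewrite -sqrtr1 ler_wsqrtr.
have td0 : 0 <= t `^ (- (d / 2)) by exact: powR_ge0.
have [t1|/ltW t1] := leP t 1.
  apply: (@le_trans _ _ (A * t `^ (- (d / 2)))); last by rewrite ler_wpM2r// lerDl.
  apply: (@le_trans _ _ (rt t `^ (- g))); first by rewrite ler_piMr ?powR_ge0.
  have k0 : 0 < expR (- 2) :> R by rewrite expR_gt0.
  rewrite E; apply: (@le_trans _ _ ((expR (- 2) * t) `^ (- (g / 2)))).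
    by rewrite anti ?tanh_ge_small ?t0// mulr_gt0.
  rewrite powRM ?(ltW k0) ?(ltW t0)// ler_wpM2l// ger_powR ?t0//; lra.
apply: (@le_trans _ _ (B * t `^ (- (d / 2)))); last by rewrite ler_wpM2r// lerDr.
rewrite /B -mulrA; apply: ler_pM; rewrite ?powR_ge0 ?sqrtr_ge0//.
  by rewrite E anti ?tanh_ge_large.
apply: (@le_trans _ _ (Num.sqrt 2 * expR (- t))).
  have -> : expR (- t) = Num.sqrt (expR (- (2 * t))).
    have -> : - (2 * t) = - t *+ 2 by ring.
    by rewrite mulr2n expRD -expr2 sqrtr_sqr ger0_norm ?expR_ge0.
  by rewrite -sqrtrM// ler_wsqrtr// ct_le_exp.
rewrite -mulrA ler_wpM2l ?sqrtr_ge0// powRN ler_pdivlMr ?powR_gt0//.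
by rewrite expRN mulrC ler_pdivrMr ?expR_gt0// powR_le_expR.
Qed.

Lemma measurable_ct : measurable_fun setT (ct : mR -> R).
Proof.
apply: measurable_inv; last by move=> t; exact/ltW/cosh_gt0.
apply: measurable_funM => //; apply: measurable_funD; apply: measurableT_comp => //.
by apply: measurableT_comp => //; exact: measurable_funM.
Qed.

Lemma measurable_rt : measurable_fun setT (rt : mR -> R).
Proof.
apply: measurable_sqrt; apply: measurable_funM; last exact: measurable_ct.
apply: measurable_funM => //; apply: measurable_funB; apply: measurableT_comp => //.
by apply: measurableT_comp => //; exact: measurable_funM.
Qed.

Lemma mehler_kern n t (x z : 'rV[R]_n) : 0 < t ->
  mehler_kernel t x z = kern (rt t) (ct t) [::] x z.
Proof.
move=> t0; have t20 : 0 < 2 * t by rewrite mulr_gt0.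
have s0 := sinh_gt0 t20; have c0 := cosh_gt0 (2 * t); have r0 := rt_gt0 t0.
have -> : kern (rt t) (ct t) [::] x z = \prod_k gker (rt t) (ct t) (x 0 k) (z 0 k).
  by apply: eq_bigr => k _; rewrite /ker1/= expr0 invr1 !mul1r.
rewrite /gker big_split/= prodr_const card_ord -expR_sum /mehler_kernel.
congr (_ * expR _).
  have p0 := @pi_gt0 R.
  have a0 : 0 < 2 * pi * sinh (2 * t) by rewrite mulr_gt0// mulr_gt0.
  have -> : Num.sqrt (ct t / (2 * pi)) / rt t = (2 * pi * sinh (2 * t)) `^ (- 2^-1).
    rewrite powRN powR12_sqrt ?(ltW a0)// -(sqrtrV (ltW a0)) /rt.
    rewrite -(sqrtrV (ltW (tanh_gt0 t20))) -sqrtrM; last first.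
      by rewrite divr_ge0 ?(ltW (ct_gt0 t)) ?mulr_ge0 ?(ltW p0).
    congr (Num.sqrt _).
    by apply: mehler_constant; rewrite gt_eqF.
  by rewrite -powR_mulrn ?powR_ge0// -powRrM; congr (_ `^ _); field.
have ra0 : 0 <= dotp (x - z) (x - z).
  by apply: sumr_ge0 => k _; rewrite -expr2 sqr_ge0.
rewrite /enorm sqr_sqrtr// /dotp mulr_sumr !mulr_suml -big_split/= -sumrN.
apply: eq_bigr => k _; rewrite !mxE exprMn expr_div_n rt2// /tanh /ct /coth.
have s1 := sinh_gt0 t0; have c1 := cosh_gt0 t.
have h1 : sinh (2 * t) = 2 * sinh t * cosh t.
  have -> : 2 * t = t + t by ring.
  by rewrite /sinh /cosh opprD !expRD; field.
have h2 : cosh (2 * t) = cosh t ^+ 2 + sinh t ^+ 2.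
  have -> : 2 * t = t + t by ring.
  by rewrite /sinh /cosh opprD !expRD; field.
apply: mehler_exponent; rewrite ?gt_eqF//.
  by have := cosh2Bsinh2 (2 * t); rewrite !expr2; lra.
(* What remains is tanh t = (cosh 2t - 1) / sinh 2t, from the duplication formulas. *)
rewrite h1 h2; have -> : cosh t ^+ 2 + sinh t ^+ 2 - 1 = 2 * sinh t ^+ 2.
  by have := cosh2Bsinh2 t; lra.
by move: (sinh t) (cosh t) (lt0r_neq0 s1) (lt0r_neq0 c1) => a b a0 b0; field; rewrite ?a0 ?b0.
Qed.

End time.

(** * Hoelder bounds of time integrals *)

Lemma le_norm_MVT (R : realType) (f f' : R -> R) (B x y : R) :
  (forall z : R, is_derive z 1 f (f' z)) -> (forall z, `|f' z| <= B) ->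
  `|f y - f x| <= B * `|y - x|.
Proof.
move=> df fB.
wlog xy : x y / x < y.
  move=> H; have [/H//|yx|->] := ltgtP x y; last by rewrite !subrr normr0 mulr0.
  by rewrite distrC (distrC y); exact: H.
have [|c _ ->] := @MVT R f f' x y xy (fun z _ => df z).
  apply: derivable_within_continuous => z _.
  exact: (@ex_derive _ _ _ _ _ _ _ (df z)).
by rewrite normrM ler_wpM2r.
Qed.

Section CH_space.
Context (R : realType) (n : nat) (alpha : R).
Hypotheses (alpha0 : 0 < alpha) (alpha1 : alpha < 1).
Local Notation mR := (measurableTypeR R).
Local Notation leb := (@lebesgue_measure R).
Hypothesis n0 : (0 < n)%N.
Implicit Types (x y : 'rV[R]_n) (u v : 'rV[R]_n -> R).

Lemma enorm_eq0 x : enorm x = 0 -> x = 0.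
Proof.
move=> x0; apply/rowP => k; rewrite mxE; apply/eqP; rewrite -normr_le0 -x0.
exact: coord_le_enorm.
Qed.

Lemma enorm_gt0 x : x != 0 -> 0 < enorm x.
Proof.
by move=> x0; rewrite lt_neqAle enorm_ge0 andbT eq_sym; apply: contraNneq x0 => /enorm_eq0 ->.
Qed.

Lemma CH_boundP u : CH alpha u -> CH_bound alpha u (fine (CH_norm alpha u)) /\
  (CH_norm alpha u = (fine (CH_norm alpha u))%:E).
Proof.
move=> [cu uoo].
have g0 : (0 <= growth_seminorm alpha u)%E.
  apply: (@le_trans _ _ ((1 + enorm (0 : 'rV[R]_n)) `^ alpha * `|u 0|)%:E).
    by rewrite lee_fin mulr_ge0 ?powR_ge0.
  by apply: ereal_sup_ubound; exists 0.
have h0 x y : x != y ->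
    ((`|u x - u y| / enorm (x - y) `^ alpha)%:E <= holder_seminorm alpha u)%E.
  by move=> xy; apply: ereal_sup_ubound; exists x, y.
(* Two distinct points are needed, since the supremum of the empty set is -oo; they exist because n
   > 0. *)
have hge0 : (0 <= holder_seminorm alpha u)%E.
  have xy : const_mx 1 != 0 :> 'rV[R]_n.
    apply/eqP => /rowP /(_ (Ordinal n0)); rewrite !mxE => /eqP.
    by rewrite oner_eq0.
  by apply: le_trans (h0 _ _ xy); rewrite lee_fin divr_ge0 ?powR_ge0.
have N0 : (0 <= CH_norm alpha u)%E by exact: adde_ge0.
have Nf : CH_norm alpha u = (fine (CH_norm alpha u))%:E.
  by rewrite fineK// ge0_fin_numE.
split => //; split; first exact: continuous_measurable_rV.
- move=> x y; have [->|xy] := eqVneq x y.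
    by rewrite !subrr normr0 mulr_ge0 ?powR_ge0// -lee_fin -Nf.
  rewrite -ler_pdivrMr ?powR_gt0 ?enorm_gt0 ?subr_eq0// -lee_fin -Nf.
  by apply: le_trans (h0 _ _ xy) _; rewrite leeDl.
- move=> x; rewrite -lee_fin -Nf.
  apply: (@le_trans _ _ (growth_seminorm alpha u)); last by rewrite leeDr.
  by apply: ereal_sup_ubound; exists x.
Qed.

Lemma CH_of_bounds v B : 0 <= B ->
  (forall x y, `|v x - v y| <= B * enorm (x - y) `^ alpha) ->
  (forall x, (1 + enorm x) `^ alpha * `|v x| <= B) ->
  CH alpha v /\ (CH_norm alpha v <= (2 * B)%:E)%E.
Proof.
move=> B0 hB gB.
have H : (CH_norm alpha v <= (2 * B)%:E)%E.
  rewrite /CH_norm mulr_natl mulr2n EFinD; apply: leeD.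
    apply: ge_ereal_sup => _ [x [y [xy ->]]]; rewrite lee_fin ler_pdivrMr ?hB//.
    by rewrite powR_gt0// enorm_gt0// subr_eq0.
  by apply: ge_ereal_sup => _ [x _ <-]; rewrite lee_fin.
split => //; split; last by apply: le_lt_trans H _; rewrite ltry.
move=> x; apply/(@cvgrPdist_le R R _ (nbhs x)) => e e0.
(* A radius for the sup norm: the Euclidean norm is at most n times it, and B + 1 keeps the quotient
   defined when B = 0. *)
pose d := (e / (B + 1)) `^ alpha^-1 / n.+1%:R.
have B1 : 0 < B + 1 by rewrite ltr_pwDr.
have eB : 0 < e / (B + 1) by rewrite divr_gt0.
have d0 : 0 < d by rewrite divr_gt0 ?powR_gt0 ?ltr0n.
near=> y.
have yx : `|x - y| <= d by near: y; exact: cvgr_dist_le.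
have h : enorm (x - y) <= (e / (B + 1)) `^ alpha^-1.
  apply: le_trans (enorm_le_sum _) _.
  apply: (@le_trans _ _ (\sum_(k < n) d)).
    apply: ler_sum => k _; apply: le_trans yx.
    rewrite /Num.norm/= mx_normrE.
    exact: (@le_bigmax _ _ _ _ (fun ij => `|(x - y) ij.1 ij.2|) (0, k)).
  rewrite sumr_const card_ord -mulr_natl /d mulrCA ler_piMr ?powR_ge0//.
  by rewrite ler_pdivrMr ?ltr0n// mul1r ler_nat.
apply: le_trans (hB x y) _.
apply: (@le_trans _ _ (B * (e / (B + 1)))).
  rewrite ler_wpM2l//; apply: (@le_trans _ _ (((e / (B + 1)) `^ alpha^-1) `^ alpha)).
    by rewrite ge0_ler_powR ?nnegrE ?enorm_ge0 ?powR_ge0 ?(ltW alpha0).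
  by rewrite -powRrM mulVf ?gt_eqF// powRr1// ltW.
rewrite mulrCA ler_piMr ?(ltW e0)// ler_pdivrMr// mul1r lerDl//.
Unshelve. all: by end_near. Qed.

Section time_integral.
(** [Phi t] stands for a constant times t^(sigma - 1) W_w(t) u with |w| <= 2 sigma. The bounds on
    x_k Phi and on increments along coordinate k are what the words with one more letter provide. *)
Variables (Phi : R -> 'rV[R]_n -> R) (B : R).
Hypothesis B0 : 0 <= B.
Let a := alpha / 2.
Hypothesis mPhi : forall x, measurable_fun setT (Phi ^~ x : mR -> R).
Hypothesis Phi_bound : forall t x, 0 < t -> `|Phi t x| <= B * hmaj a 1 t.
Hypothesis Phi_mul : forall t x k, 0 < t -> `|x 0 k * Phi t x| <= B * t `^ (a - 3 / 2).
Hypothesis Phi_lip : forall t x k (y : R), 0 < t ->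
  `|Phi t (upd x k y) - Phi t x| <= B * t `^ (a - 3 / 2) * `|y - x 0 k|.

(** A path from x to y that changes one coordinate at a time, as the Lipschitz hypothesis concerns
    single coordinates. *)
Definition mix (m : nat) x y : 'rV[R]_n := \row_j (if (j < m)%N then y 0 j else x 0 j).

Let mixS x y (k : 'I_n) : mix k.+1 x y = upd (mix k x y) k (y 0 k).
Proof.
apply/rowP => j; rewrite !mxE ltnS leq_eqVlt -(inj_eq val_inj)/=.
by case: eqP => //= /val_inj ->.
Qed.

Let Phi_lipschitz t x y : 0 < t ->
  `|Phi t x - Phi t y| <= n%:R * B * t `^ (a - 3 / 2) * enorm (x - y).
Proof.
move=> t0; have H m : (m <= n)%N ->
    `|Phi t (mix m x y) - Phi t x| <= m%:R * (B * t `^ (a - 3 / 2) * enorm (x - y)).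
  elim: m => [_|m IH mn].
    have -> : mix 0 x y = x by apply/rowP => j; rewrite mxE ltn0.
    by rewrite subrr normr0 mul0r.
  have := mixS x y (Ordinal mn) => /= ->.
  apply: le_trans (ler_distD (Phi t (mix m x y)) _ _) _.
  rewrite -natr1 mulrDl mul1r addrC; apply: lerD; first exact/IH/ltnW.
  apply: le_trans (Phi_lip _ _ _ t0) _; rewrite ler_wpM2l ?mulr_ge0 ?powR_ge0//.
  rewrite mxE /= ltnn distrC; have := coord_le_enorm (x - y) (Ordinal mn).
  by rewrite !mxE.
have := H n (leqnn n); have -> : mix n x y = y by apply/rowP => j; rewrite mxE ltn_ord.
by rewrite distrC !mulrA.
Qed.

Let hmaj_le t (d : R) : hmaj a d t <= d * t `^ (a - 3 / 2).
Proof. by rewrite /hmaj ge_min lexx orbT. Qed.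

Let hmaj_le1 t (d : R) : hmaj a d t <= t `^ (a - 1).
Proof. by rewrite /hmaj ge_min lexx. Qed.

(** Adding the bounds on |Phi| and on all |x_k Phi| bounds (1 + |x|) |Phi|, so growth has the same
    form as an increment over the distance 1 / (1 + |x|). *)
Let Phi_growth t x : 0 < t -> `|Phi t x| <= n.+1%:R * B * hmaj a (1 + enorm x)^-1 t.
Proof.
move=> t0; have e1 : 0 < 1 + enorm x by rewrite ltr_pwDl// enorm_ge0.
have n1 : 1 <= n.+1%:R :> R by rewrite ler1n.
rewrite /hmaj minr_pMr; last by rewrite mulr_ge0.
rewrite le_min; apply/andP; split.
  apply: le_trans (Phi_bound x t0) _; rewrite ler_pM ?hmaj_ge0 ?hmaj_le1//.
  by rewrite ler_peMl.
rewrite mulrCA ler_pdivlMl//.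
rewrite mulrDl mul1r.
have h1 : enorm x * `|Phi t x| <= n%:R * (B * t `^ (a - 3 / 2)).
  apply: le_trans (ler_wpM2r (normr_ge0 _) (enorm_le_sum x)) _.
  rewrite mulr_suml -[X in X%:R](card_ord n) mulr_natl -sumr_const.
  by apply: ler_sum => k _; rewrite -normrM; exact: Phi_mul.
have h2 : `|Phi t x| <= B * t `^ (a - 3 / 2).
  by apply: le_trans (Phi_bound x t0) _; rewrite ler_wpM2l// -[leRHS]mul1r hmaj_le.
rewrite -natr1; have -> : (n%:R + 1) * B * t `^ (a - 3 / 2) =
  B * t `^ (a - 3 / 2) + n%:R * (B * t `^ (a - 3 / 2)) by ring.
exact: lerD.
Qed.

Let Phi_holder t x y : 0 < t -> `|Phi t x - Phi t y| <= n.+2%:R * B * hmaj a (enorm (x - y)) t.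
Proof.
move=> t0.
rewrite /hmaj minr_pMr; last by rewrite mulr_ge0.
rewrite le_min; apply/andP; split.
  apply: (@le_trans _ _ (2 * B * t `^ (a - 1))).
    apply: le_trans (ler_normB _ _) _; rewrite -mulrA mulr_natl mulr2n.
    by apply: lerD; apply: le_trans (Phi_bound _ t0) _; rewrite ler_wpM2l ?hmaj_le1.
  by rewrite ler_wpM2r ?powR_ge0// ler_wpM2r// ler_nat.
apply: le_trans (Phi_lipschitz _ _ t0) _.
rewrite [leRHS]mulrA mulrAC ler_wpM2r ?powR_ge0// ler_wpM2r ?enorm_ge0//.
by rewrite ler_wpM2r// ler_nat; do 2 apply: leqW.
Qed.

(** The second factor comes from the integral of [hmaj]; n + 2 dominates the constants n + 1 of
    [Phi_growth] and n + 2 of [Phi_holder]. *)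
Definition tconst : R := n.+2%:R * (a^-1 + (1 / 2 - a)^-1).

Let D : set mR := `]0%R, +oo[%classic.
Let mD : measurable D. Proof. exact: measurable_itv. Qed.
Let a0 : 0 < a. Proof. by rewrite /a divr_gt0. Qed.
Let a1 : a < 1 / 2. Proof. by rewrite /a ltr_pM2r// invr_gt0. Qed.

Lemma Phi_integrable x : leb.-integrable D (EFin \o (Phi ^~ x)).
Proof.
apply: (@integrable_dom _ mR R leb D (Phi ^~ x) (fun t => B * hmaj a 1 t)) => //.
- exact: measurable_funTS.
- exact: (integrableZl mD B (integrable_hmaj a0 a1 ltr01)).
- by move=> t; rewrite /D/= in_itv/= andbT => t0; exact: Phi_bound.
Qed.

Lemma CH_time_integral (v := fun x => \int[leb]_(t in D) Phi t x) :
  CH alpha v /\ (CH_norm alpha v <= (2 * (tconst * B))%:E)%E.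
Proof.
have K0 : 0 <= a^-1 + (1 / 2 - a)^-1.
  by rewrite addr_ge0 ?invr_ge0 ?(ltW a0)// subr_ge0 ltW.
apply: CH_of_bounds.
- by rewrite mulr_ge0// /tconst mulr_ge0.
- move=> x y; have [->|xy] := eqVneq x y.
    by rewrite !subrr normr0 mulr_ge0 ?powR_ge0// mulr_ge0// /tconst mulr_ge0.
  have d0 : 0 < enorm (x - y) by rewrite enorm_gt0// subr_eq0.
  rewrite /v -RintegralB//; [|exact: Phi_integrable..].
  apply: (@le_trans _ _ (\int[leb]_(t in D) (n.+2%:R * B * hmaj a (enorm (x - y)) t))).
    apply: Rintegral_dom => //.
    + by apply: measurable_funTS; apply: measurable_funB.
    + exact: (integrableZl mD _ (integrable_hmaj a0 a1 d0)).
    + by move=> t; rewrite /D/= in_itv/= andbT => t0; exact: Phi_holder.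
  rewrite RintegralZl//; last exact: integrable_hmaj.
  apply: le_trans (ler_wpM2l _ (Rintegral_hmaj a0 a1 d0)) _; first by rewrite mulr_ge0.
  have -> : 2 * a = alpha by rewrite /a mulrC divfK.
  by rewrite /tconst le_eqVlt; apply/orP; left; apply/eqP; ring.
- move=> x; have e1 : 0 < 1 + enorm x by rewrite ltr_pwDl// enorm_ge0.
  have d0 : 0 < (1 + enorm x)^-1 by rewrite invr_gt0.
  rewrite mulrC -ler_pdivlMr ?powR_gt0//.
  apply: (@le_trans _ _ (\int[leb]_(t in D) (n.+1%:R * B * hmaj a (1 + enorm x)^-1 t))).
    apply: Rintegral_dom => //.
    + exact: measurable_funTS.
    + exact: (integrableZl mD _ (integrable_hmaj a0 a1 d0)).
    + by move=> t; rewrite /D/= in_itv/= andbT => t0; exact: Phi_growth.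
  rewrite RintegralZl//; last exact: integrable_hmaj.
  apply: le_trans (ler_wpM2l _ (Rintegral_hmaj a0 a1 d0)) _; first by rewrite mulr_ge0.
  have -> : 2 * a = alpha by rewrite /a mulrC divfK.
  have -> : (1 + enorm x)^-1 `^ alpha = ((1 + enorm x) `^ alpha)^-1.
    by rewrite -powR_inv1 ?(ltW e1)// -powRrM mulN1r powRN.
  rewrite mulrA ler_wpM2r ?invr_ge0 ?powR_ge0// /tconst.
  rewrite -mulrA [B * _]mulrC mulrA ler_wpM2r// ler_wpM2r// ler_nat//.
Qed.

End time_integral.

End CH_space.

(** * Test functions *)

Section test_functions.
Context (R : realType) (n : nat).
Local Notation mR := (measurableTypeR R).
Local Notation leb := (@lebesgue_measure R).
Local Notation L := (lebesgue_tuple R n).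
Implicit Types (x y : 'rV[R]_n) (phi psi : 'rV[R]_n -> R) (k : 'I_n).

(* The majorant is an integrable product, so that Fubini applies coordinatewise. *)
Definition fast phi := exists M : R, forall x,
  `|phi x| <= M * \prod_k cauchy_fun (x 0 k).

(** What one integration by parts uses of a test function. In a second order transform the inner
    operator is tested against x_k phi and the partial derivatives of phi, for which membership in
    this class suffices. *)
Record test phi : Prop := Test {
  test_diff : forall x, differentiable phi x ;
  test_cont : forall k, continuous (partial k phi) ;
  test_fast : fast phi ;
  test_fast_partial : forall k, fast (partial k phi) ;
  test_fast_mulX : forall k, fast (fun x => x 0 k * phi x) }.

(** Two powers of 1 + |x| for each coordinate, since (1 + |x|)^2 >= 1 + x_k^2 for every k. *)
Lemma fast_of_decay phi (M : R) :
  (forall x, (1 + enorm x) ^+ (2 * n) * `|phi x| <= M) -> fast phi.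
Proof.
move=> H; exists M => x; apply: (@le_trans _ _ (M * (1 + enorm x) ^- (2 * n))).
  rewrite ler_pdivlMr 1?mulrC ?H// exprn_gt0// ltr_pwDl// enorm_ge0.
  by [].
have M0 : 0 <= M by apply: le_trans (H x); rewrite mulr_ge0 ?exprn_ge0 ?addr_ge0 ?enorm_ge0.
rewrite ler_wpM2l// exprM -exprVn -[X in _ ^+ X](card_ord n) -prodr_const.
apply: ler_prod => k _; rewrite invr_ge0 exprn_ge0 ?addr_ge0 ?enorm_ge0//=.
have e0 := enorm_ge0 x.
rewrite /cauchy_fun lef_pV2 ?posrE ?exprn_gt0 ?ltr_pwDl ?sqr_ge0//.
rewrite /oneDsqr -[x 0 k ^+ 2]real_normK ?num_real//.
have := coord_le_enorm x k; have := normr_ge0 (x 0 k); nra.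
Qed.

Lemma updD x k (y h : R) : upd x k (h + y) = h *: delta_mx 0 k + upd x k y.
Proof.
by apply/rowP => j; rewrite !mxE /= ; case: eqP => _; rewrite ?mulr1 ?mulr0 ?add0r.
Qed.

Lemma is_derive_upd phi x k (y : R) : differentiable phi (upd x k y) ->
  is_derive y 1 (fun y : R => phi (upd x k y)) (partial k phi (upd x k y)).
Proof.
move=> dphi; have D : derivable phi (upd x k y) (delta_mx 0 k) by exact: diff_derivable.
have E : (fun h : R => h^-1 *: (phi (upd x k (h *: 1 + y)) - phi (upd x k y))) =
  (fun h : R => h^-1 *: (phi (h *: delta_mx 0 k + upd x k y) - phi (upd x k y))).
  by apply/funext => h; rewrite -updD /GRing.scale/= mulr1.
apply: DeriveDef.
  by rewrite /derivable E.
by rewrite /derive E.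
Qed.

Lemma continuous_upd x k : continuous (fun y : R => upd x k y).
Proof.
move=> y; apply/(@cvg_ballP R _ _ _ (nbhs_filter y)) => e e0.
near=> z; split => // i j; rewrite ord1 !updE; case: ifP => _; last exact: ballxx.
by near: z; exact: nbhsx_ballx.
Unshelve. all: by end_near. Qed.

Definition decay phi := forall N : nat, exists M : R, forall x,
  (1 + enorm x) ^+ N * `|phi x| <= M.

Lemma decay_fast phi : decay phi -> fast phi.
Proof. by move=> /(_ (2 * n)%N)[M]; exact: fast_of_decay. Qed.

Lemma decay_add phi psi : decay phi -> decay psi -> decay (fun x => phi x + psi x).
Proof.
move=> h1 h2 N; have [M1 H1] := h1 N; have [M2 H2] := h2 N.
exists (M1 + M2) => x; apply: (@le_trans _ _ ((1 + enorm x) ^+ N * (`|phi x| + `|psi x|))).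
  by rewrite ler_wpM2l ?ler_normD// exprn_ge0// addr_ge0// enorm_ge0.
by rewrite mulrDr lerD.
Qed.

Lemma decay_mulX phi k : decay phi -> decay (fun x => x 0 k * phi x).
Proof.
move=> h N; have [M H] := h N.+1; exists M => x; apply: le_trans (H x).
have e0 := enorm_ge0 x.
rewrite exprSr -mulrA ler_wpM2l ?exprn_ge0 ?addr_ge0// normrM ler_wpM2r//.
by apply: le_trans (coord_le_enorm x k) _; rewrite lerDr.
Qed.

Lemma decay_scale phi (a : R) : decay phi -> decay (fun x => a * phi x).
Proof.
move=> h N; have [M H] := h N; exists (`|a| * M) => x.
by rewrite normrM mulrCA ler_wpM2l.
Qed.

Lemma schwartz_decay phi s : schwartz phi -> decay (iter_partial s phi).
Proof. by move=> [_ H] N; exact: H. Qed.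

Lemma test_of_decay phi : (forall x, differentiable phi x) ->
  (forall k x, {for x, continuous (partial k phi)}) -> decay phi ->
  (forall k, decay (partial k phi)) -> test phi.
Proof.
move=> h1 h2 h3 h4; split => //.
- exact: decay_fast.
- by move=> k; exact: decay_fast.
- by move=> k; apply: decay_fast; exact: decay_mulX.
Qed.

Lemma schwartz_test_iter phi s : schwartz phi -> test (iter_partial s phi).
Proof.
move=> sphi; apply: test_of_decay.
- exact: sphi.1 s.
- by move=> k x; apply: differentiable_continuous; exact: (sphi.1 (k :: s) x).
- exact: schwartz_decay.
- by move=> k; exact: (schwartz_decay (k :: s) sphi).
Qed.

Lemma differentiable_mulX phi i : (forall x, differentiable phi x) ->
  forall x, differentiable (fun x => x 0 i * phi x) x.
Proof.
move=> dphi x.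
exact: (differentiableM (differentiable_coord x 0 i) (dphi x)).
Qed.

Lemma partial_mulX phi i k : (forall x, differentiable phi x) ->
  partial k (fun x => x 0 i * phi x) =
  (fun x => (i == k)%:R * phi x + x 0 i * partial k phi x).
Proof.
move=> dphi; apply/funext => x.
have h1 := is_derive_upd (differentiable_mulX i dphi (upd x k (x 0 k))).
have h2 := is_derive_upd (dphi (upd x k (x 0 k))).
have h3 : is_derive (x 0 k) 1 (fun y : R => upd x k y 0 i) (i == k)%:R.
  apply: (@is_derive_ext _ _ (fun y : R => (i == k)%:R * y + (i != k)%:R * x 0 i) _ _ _ _ _
    (is_derive_affine (i == k)%:R ((i != k)%:R * x 0 i) (x 0 k))) => // y.
  by rewrite updE; case: eqP => _; rewrite ?mul1r ?mul0r ?addr0 ?add0r.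
have h4 := is_derive_mul h3 h2.
have e1 := @derive_val _ _ _ _ _ _ _ h1; have e4 := @derive_val _ _ _ _ _ _ _ h4.
by rewrite e1 upd_id in e4.
Qed.

Lemma schwartz_test_mulX phi i : schwartz phi -> test (fun x => x 0 i * phi x).
Proof.
move=> sphi; have dphi := sphi.1 [::].
have dk k := sphi.1 [:: k].
apply: test_of_decay.
- exact: differentiable_mulX.
- move=> k x; rewrite partial_mulX//; apply: differentiable_continuous.
  exact: (differentiableD (differentiableM (differentiable_cst _ _) (dphi x))
    (differentiable_mulX i (dk k) x)).
- by apply: decay_mulX; exact: (schwartz_decay [::] sphi).
- move=> k; rewrite partial_mulX//; apply: decay_add.
    by apply: decay_scale; exact: (schwartz_decay [::] sphi).
  by apply: decay_mulX; exact: (schwartz_decay [:: k] sphi).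
Qed.

Lemma measurable_diff phi : (forall x, differentiable phi x) ->
  measurable_fun setT (phi \o @tuple_rV R n).
Proof.
move=> h; apply: continuous_measurable_rV => x; exact: differentiable_continuous.
Qed.

(** * Integration by parts for W_w u against test functions *)

Section ibp.
Variables (u : 'rV[R]_n -> R) (M : R).
Hypothesis mu : measurable_fun setT (u \o @tuple_rV R n).
Hypothesis uM : forall z, `|u z| <= M.

Lemma measurable_kint_joint d (T : measurableType d) w (r c : T -> R) (x : T -> 'rV[R]_n) :
  measurable_fun setT r -> measurable_fun setT c ->
  (forall k, measurable_fun setT (fun p => x p 0 k)) -> (forall p, 0 <= r p) ->
  measurable_fun setT (fun p => kint (r p) (c p) w u (x p)).
Proof.
move=> mr mc mx r0.
have mf : measurable_fun setT (fun q : T * n.-tuple mR =>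
    kern (r q.1) (c q.1) w (x q.1) (tuple_rV q.2) * u (tuple_rV q.2)).
  apply: measurable_funM; last first.
    by apply: (@measurableT_comp _ _ _ _ _ _ (u \o @tuple_rV R n)) => //.
  apply: measurable_kern => //.
  - by apply: (measurableT_comp mr).
  - by apply: (measurableT_comp mc).
  - by move=> k; apply: (measurableT_comp (mx k)).
  - move=> k; under eq_fun do rewrite tuple_rVE.
    by apply: (measurableT_comp (measurable_tnth k)).
exact: (measurable_Rintegral1 L mf).
Qed.

Lemma measurable_kint r c w : 0 <= r ->
  measurable_fun setT (kint r c w u \o @tuple_rV R n).
Proof.
move=> r0; apply: (@measurable_kint_joint _ _ w (fun=> r) (fun=> c) (@tuple_rV R n)) => //.
by move=> k; under eq_fun do rewrite tuple_rVE; exact: measurable_tnth.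
Qed.

(** The function [f] of the proof is the k-th partial derivative of W_w u times phi. Its integral
    along every line in direction k vanishes, hence so does its integral over the whole space by
    [Rintegral_slice0]. *)
Lemma kint_ibp r c w k phi : 0 < r <= 1 -> 0 < c <= 1 -> test phi ->
  - integral_rV (fun x => kint r c w u x * partial k phi x) =
  integral_rV (fun x => (kint r c ((false, k) :: w) u x -
    kint r c ((true, k) :: w) u x) / 2 * phi x).
Proof.
move=> r01 c01 tphi; have /andP[r0 _] := r01.
have bnd w' : exists2 K : R, 0 <= K & forall x, `|kint r c w' u x| <= K.
  have [C C0 H] := kint_bound0 R w'.
  exists (C * M * r ^- size w' * Num.sqrt (2 * c) ^+ n).
    by apply: le_trans (normr_ge0 _) (H r c u M 0 mu uM r01 c01).
  by move=> x; exact: H.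
have [K0 K00 H0] := bnd w; have [K1 K10 H1] := bnd ((false, k) :: w).
have [K2 K20 H2] := bnd ((true, k) :: w).
have [M0 HM0] := test_fast tphi; have [M1 HM1] := test_fast_partial tphi k.
pose dk x := (kint r c ((false, k) :: w) u x - kint r c ((true, k) :: w) u x) / 2.
have Hd x : `|dk x| <= (K1 + K2) / 2.
  rewrite normrM (@ger0_norm _ 2^-1)// ler_wpM2r//.
  by apply: le_trans (ler_normB _ _) _; rewrite lerD.
pose f x := dk x * phi x + kint r c w u x * partial k phi x.
have fb1 x : `|dk x * phi x| <= (K1 + K2) / 2 * M0 * \prod_k cauchy_fun (x 0 k).
  by rewrite normrM -mulrA ler_pM.
have fb2 x : `|kint r c w u x * partial k phi x| <= K0 * M1 * \prod_k cauchy_fun (x 0 k).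
  by rewrite normrM -mulrA ler_pM.
have fb x : `|f x| <= ((K1 + K2) / 2 * M0 + K0 * M1) * \prod_k cauchy_fun (x 0 k).
  by rewrite mulrDl (le_trans (ler_normD _ _))// lerD.
have mphi := measurable_diff (test_diff tphi).
have mpphi := continuous_measurable_rV (@test_cont _ tphi k).
have mk w' := measurable_kint c w' (ltW r0).
have m1 : measurable_fun setT ((fun x => dk x * phi x) \o @tuple_rV R n).
  have mdk : measurable_fun setT (dk \o @tuple_rV R n).
    apply: measurable_funM; last exact: measurable_cst.
    exact: (measurable_funB (mk _) (mk _)).
  exact: (measurable_funM mdk mphi).
have m2 : measurable_fun setT ((fun x => kint r c w u x * partial k phi x) \o @tuple_rV R n).
  exact: (measurable_funM (mk w) mpphi).
have ic : L.-integrable setT (EFin \o (fun t => \prod_k cauchy_fun (tnth t k))).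
  apply: (@integrable_prod_tnth R n (fun=> @cauchy_fun R)).
    by move=> _ y; exact/ltW/cauchy_fun_gt0.
  by move=> _; exact: integrable_cauchy_fun.
have prodE (t : n.-tuple mR) :
    \prod_k cauchy_fun (tuple_rV t 0 k) = \prod_k cauchy_fun (tnth t k).
  by apply: eq_bigr => j _; rewrite tuple_rVE.
have i1 : L.-integrable setT (EFin \o (fun t => dk (tuple_rV t) * phi (tuple_rV t))).
  apply: (integrable_dom measurableT m1 (integrableZl measurableT ((K1 + K2) / 2 * M0) ic)).
  by move=> t _ /=; rewrite -prodE; exact: fb1.
have i2 : L.-integrable setT (EFin \o (fun t => kint r c w u (tuple_rV t) * partial k phi (tuple_rV t))).
  apply: (integrable_dom measurableT m2 (integrableZl measurableT (K0 * M1) ic)).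
  by move=> t _ /=; rewrite -prodE; exact: fb2.
suff : \int[L]_t f (tuple_rV t) = 0.
  rewrite /f RintegralD// => /eqP; rewrite addr_eq0 => /eqP e.
  by rewrite /integral_rV -[RHS]/(\int[L]_t (dk (tuple_rV t) * phi (tuple_rV t))) e.
apply: (@Rintegral_slice0 R n k _ (@cauchy_fun R) ((K1 + K2) / 2 * M0 + K0 * M1)).
- exact: measurable_funD.
- exact: integrable_cauchy_fun.
- by move=> y; exact/ltW/cauchy_fun_gt0.
- by move=> t; rewrite -prodE; exact: fb.
move=> t; pose x := tuple_rV t.
pose F (y : mR) : R := kint r c w u (upd x k y) * phi (upd x k y).
pose P := \prod_(j | j != k) cauchy_fun (x 0 j).
have prodU (y : R) : \prod_j cauchy_fun (upd x k y 0 j) = cauchy_fun y * P.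
  rewrite (bigD1 k)//= updE eqxx; congr (_ * _).
  by apply: eq_bigr => j /negbTE jk; rewrite updE jk.
transitivity (\int[leb]_y f (upd x k y)).
  by apply: eq_Rintegral => y _; rewrite tuple_rV_upd.
have ck w' (y : R) : {for y, continuous (fun y : R => kint r c w' u (upd x k y))}.
  exact: is_derive_continuous (is_derive_kint mu uM w' x k y r01 c01).
have cphi (y : R) : {for y, continuous (fun y : R => phi (upd x k y))}.
  exact: is_derive_continuous (is_derive_upd (test_diff tphi _)).
have cpphi (y : R) : {for y, continuous (fun y : R => partial k phi (upd x k y))}.
  exact: (cvg_comp _ _ (@continuous_upd x k y) (@test_cont _ tphi k (upd x k y))).
have cf : continuous (fun y : R => f (upd x k y)).
  move=> y; apply: cvgD; apply: cvgM; [|exact: cphi|exact: ck|exact: cpphi].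
  by apply: cvgMr_tmp; apply: cvgB; exact: ck.
apply: (@Rintegral_derive0 R F _ (K0 * M0 * P)) => //.
- move=> y; exact: (is_derive_mul (is_derive_kint mu uM w x k y r01 c01)
    (is_derive_upd (test_diff tphi _))).
- move=> y; rewrite /F normrM.
  have -> : K0 * M0 * P * cauchy_fun y = K0 * (M0 * (cauchy_fun y * P)) by ring.
  by rewrite -prodU ler_pM.
- have mfy : measurable_fun setT (fun y : mR => f (upd x k y)).
    exact: (continuous_measurable_fun cf).
  have ig := integrableZl measurableT (((K1 + K2) / 2 * M0 + K0 * M1) * P)
    (integrable_cauchy_fun R).
  apply: (integrable_dom measurableT mfy ig) => y _ /=.
  by have := fb (upd x k y); rewrite prodU [cauchy_fun y * P]mulrC mulrA.
Qed.

End ibp.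

End test_functions.

(** * The Riesz transforms *)

(** There are finitely many letters, hence finitely many words of length at most m, and the
    constants of all of them can be added up. *)
Lemma uniform_words (R : realType) n (m : nat) (Q : seq (hindex n) -> R -> Prop) :
  (forall w C C', C <= C' -> Q w C -> Q w C') ->
  (forall w, exists2 C : R, 0 <= C & Q w C) ->
  exists2 C : R, 0 <= C & forall w, (size w <= m)%N -> Q w C.
Proof.
elim: m Q => [|m IH] Q mono HQ.
  by have [C C0 H] := HQ [::]; exists C => // -[].
have [C C0 H] := HQ [::].
have [C' C'0 H'] : exists2 C : R, 0 <= C & forall w, (size w <= m)%N ->
    forall i : bool * 'I_n, Q (i :: w) C.
  apply: (IH (fun w C => forall i : bool * 'I_n, Q (i :: w) C)).
    by move=> w C1 C2 C12 h i; exact: mono C12 (h i).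
  move=> w; have /choice[c Hc] : forall i : bool * 'I_n, exists C : R, 0 <= C /\ Q (i :: w) C.
    by move=> i; have [C1 C10 HC1] := HQ (i :: w); exists C1.
  exists (\sum_i c i); first by rewrite sumr_ge0// => i _; case: (Hc i).
  move=> i; apply: (mono _ (c i)); last by case: (Hc i).
  by rewrite (bigD1 i)//= lerDl sumr_ge0// => j _; case: (Hc j).
exists (C + C'); first exact: addr_ge0.
move=> [|i w] /= sw; first by apply: (mono _ C) => //; rewrite lerDl.
by apply: (mono _ C'); rewrite ?lerDr//; exact: H'.
Qed.

Lemma sign_split (F : realFieldType) (b : bool) (g : F) (J : bool -> F) :
  g * J b = (-1) ^+ b * (g * ((J false - J true) / 2)) + g * ((J false + J true) / 2).
Proof. by case: b; rewrite ?expr1 ?expr0; field. Qed.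

Section fubini_on.
Context d1 d2 (T1 : measurableType d1) (T2 : measurableType d2) (R : realType).
Variables (m1 : {sigma_finite_measure set T1 -> \bar R})
  (m2 : {sigma_finite_measure set T2 -> \bar R}).

(** Multiplying f by the indicator of D makes the product majorant hold everywhere, which reduces
    the exchange to the one on the whole space. *)
Lemma Rfubini_on (D : set T1) (f : T1 * T2 -> R) (g : T1 -> R) (h : T2 -> R) :
  measurable D -> measurable_fun setT f -> m1.-integrable D (EFin \o g) ->
  m2.-integrable setT (EFin \o h) ->
  (forall x y, D x -> `|f (x, y)| <= g x * h y) ->
  m1.-integrable D (EFin \o (fun x => \int[m2]_y f (x, y))) /\
  \int[m2]_y \int[m1]_(x in D) f (x, y) = \int[m1]_(x in D) \int[m2]_y f (x, y).
Proof.
move=> mD mf ig ih fgh; split.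
  have mI : measurable_fun D (fun x => \int[m2]_y f (x, y)).
    by apply: measurable_funTS; exact: measurable_Rintegral1.
  apply: (integrable_dom mD mI (integrableZl mD (\int[m2]_y h y) ig)) => x Dx /=.
  rewrite mulrC -RintegralZl//; apply: Rintegral_dom => //.
  - exact: measurable_slice1.
  - exact: (integrableZl measurableT (g x) ih).
  - by move=> y _; exact: fgh.
pose f' q : R := \1_D q.1 * f q.
have mf' : measurable_fun setT f'.
  apply: measurable_funM => //.
  by apply: (@measurableT_comp _ _ _ _ _ _ (\1_D : T1 -> R)); first exact: measurable_indic.
have ig' : m1.-integrable setT (EFin \o (g \_ D)).
  have := (integrable_mkcond (EFin \o g) mD).1 ig.
  by apply: eq_integrable => // x _; rewrite /patch/=; case: ifP.
have fgh' x y : `|f' (x, y)| <= (g \_ D) x * h y.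
  rewrite /f' /= indicE /patch; case: ifPn => [|_]; last by rewrite mul0r normr0 mul0r.
  by rewrite inE mul1r => Dx; exact: fgh.
have := Rfubini mf' ig' ih fgh' => e.
rewrite [RHS]Rintegral_mkcond; transitivity (\int[m2]_y \int[m1]_x f' (x, y)).
  apply: eq_Rintegral => y _; rewrite Rintegral_mkcond; apply: eq_Rintegral => x _.
  by rewrite /f' /= indicE /patch; case: ifP; rewrite ?mul1r ?mul0r.
rewrite -e; apply: eq_Rintegral => x _; rewrite /f' /patch /= indicE.
case: ifP => _; last by apply: Rintegral_eq0 => y; rewrite mul0r.
by apply: eq_Rintegral => y _; rewrite mul1r.
Qed.

Lemma Rintegral_lin (D : set T1) (F1 F2 F3 : T1 -> R) (c : R) : measurable D ->
  m1.-integrable D (EFin \o F1) -> m1.-integrable D (EFin \o F2) ->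
  (forall t, D t -> F3 t = c * - F1 t + F2 t) ->
  c * - (\int[m1]_(t in D) F1 t) + \int[m1]_(t in D) F2 t = \int[m1]_(t in D) F3 t.
Proof.
move=> mD i1 i2 H; have iN := integrableZl mD (- c) i1.
rewrite mulrN -mulNr -RintegralZl// -RintegralD//.
by apply: eq_Rintegral => t; rewrite inE => Dt; rewrite H// mulrN mulNr.
Qed.

End fubini_on.

(** * The time integrals and the action of A_i on them *)

Section transform.
Context (R : realType) (n : nat) (alpha : R).
Hypotheses (alpha0 : 0 < alpha) (alpha1 : alpha < 1) (n0 : (0 < n)%N).
Local Notation mR := (measurableTypeR R).
Local Notation leb := (@lebesgue_measure R).
Local Notation L := (lebesgue_tuple R n).
Local Notation D := (`]0%R, +oo[%classic : set mR).
Implicit Types (x : 'rV[R]_n) (w : seq (hindex n)) (u : 'rV[R]_n -> R).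

Lemma integrable_prod_cauchy :
  L.-integrable setT (EFin \o (fun t => \prod_k cauchy_fun (tuple_rV t 0 k))).
Proof.
have ic : L.-integrable setT (EFin \o (fun t => \prod_k cauchy_fun (tnth t k))).
  apply: (@integrable_prod_tnth R n (fun=> @cauchy_fun R)).
    by move=> _ y; exact/ltW/cauchy_fun_gt0.
  by move=> _; exact: integrable_cauchy_fun.
apply: eq_integrable ic => // t _ /=; congr EFin.
by apply: eq_bigr => j _; rewrite tuple_rVE.
Qed.

Definition heat w u (t : R) x : R := kint (rt t) (ct t) w u x.

Lemma heat_decay (m : nat) (d : R) : 0 <= d -> m%:R - alpha <= d ->
  exists2 C : R, 0 <= C & forall w, (size w <= m)%N ->
  forall u M t x, CH_bound alpha u M -> 0 < t ->
  `|heat w u t x| <= C * M * t `^ (- (d / 2)).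
Proof.
move=> d0 md.
(* The length condition is repeated inside the predicate because [uniform_words] asks for a constant
   for every word; for longer words the claim is then vacuous. *)
suff [C C0 H] : exists2 C : R, 0 <= C & forall w, (size w <= m)%N ->
    (size w <= m)%N -> forall u M t x, CH_bound alpha u M -> 0 < t ->
    `|heat w u t x| <= C * M * t `^ (- (d / 2)).
  by exists C => // w sw; exact: H.
apply: (@uniform_words R n m (fun w C => (size w <= m)%N ->
  forall u M t x, CH_bound alpha u M -> 0 < t ->
  `|heat w u t x| <= C * M * t `^ (- (d / 2)))).
  move=> w C C' CC' H sw u M t x uM t0; apply: le_trans (H sw u M t x uM t0) _.
  by rewrite ler_wpM2r ?powR_ge0// ler_wpM2r// (CHb_ge0 alpha0 uM).
(* As n > 0, at least one factor sqrt c is present; the decay for large t uses only that one. *)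
have sqn (t : R) : Num.sqrt (ct t) ^+ n <= Num.sqrt (ct t).
  have /andP[c0 c1] := ct01 t; rewrite -[leRHS]expr1 ler_wiXn2l ?sqrtr_ge0//.
  by rewrite -sqrtr1 ler_wsqrtr.
move=> [|i w].
  have [C2 C20 H2] := @time_decay R 0 d (lexx 0) d0.
  have [C C0 H] := @kint_bound0 R n [::].
  exists (C * Num.sqrt 2 ^+ n * C2); first by rewrite !mulr_ge0// exprn_ge0// sqrtr_ge0.
  move=> _ u M t x uM t0; have M0 := CHb_ge0 alpha0 uM.
  apply: le_trans (H _ _ u M x (CHb_meas uM) (CHb_sup alpha0 uM) (rt01 t0) (ct01 t)) _.
  have := H2 t t0; rewrite oppr0 powRr0 mul1r => h2.
  rewrite expr0 invr1 mulr1 sqrtrM// exprMn.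
  have -> : C * Num.sqrt 2 ^+ n * C2 * M * t `^ (- (d / 2)) =
    C * M * (Num.sqrt 2 ^+ n * (C2 * t `^ (- (d / 2)))) by ring.
  rewrite ler_wpM2l ?mulr_ge0// ler_wpM2l ?exprn_ge0 ?sqrtr_ge0//.
  exact: le_trans (sqn t) h2.
have sw0 : (0 < size (i :: w))%N by [].
have [C C0 H] := kint_bound alpha0 alpha1 sw0.
have [sw|] := boolP (size (i :: w) <= m)%N; last first.
  by move=> /negP nsw; exists 0 => // sw; case: (nsw sw).
have g0 : 0 <= (size (i :: w))%:R - alpha.
  by rewrite subr_ge0 (le_trans (ltW alpha1))// ler1n.
have gd : (size (i :: w))%:R - alpha <= d.
  by apply: le_trans md; rewrite lerB// ler_nat.
have [C2 C20 H2] := time_decay g0 gd.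
exists (C * C2); first exact: mulr_ge0.
move=> _ u M t x uM t0; have M0 := CHb_ge0 alpha0 uM.
apply: le_trans (H _ _ _ _ x (rt_gt0 t0) (ct_gt0 t) (ct_rt t0) uM) _.
apply: (@le_trans _ _ (C * M * (rt t `^ (- ((size (i :: w))%:R - alpha)) * Num.sqrt (ct t)))).
  rewrite opprB [leRHS]mulrA; apply: ler_wpM2l; last exact: sqn.
  by rewrite !mulr_ge0// powR_ge0.
have -> : C * C2 * M * t `^ (- (d / 2)) = C * M * (C2 * t `^ (- (d / 2))) by ring.
by rewrite ler_wpM2l ?mulr_ge0// H2.
Qed.

(** [G] stands for 1 / Gamma(sigma) and [s] for sigma. Below, s = p / 2, where p is the order of the
    transform. *)
Definition hint (G s : R) w u (t : R) x : R := G * (t `^ (s - 1) * heat w u t x).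

Definition htrans (G s : R) w u x : R := \int[leb]_(t in D) hint G s w u t x.

Section order.
Variables (G : R) (p : nat).
Hypothesis p0 : (0 < p)%N.
Let s : R := p%:R / 2.

Let powR_time (d t : R) : 0 < t -> t `^ (s - 1) * t `^ (- (d / 2)) = t `^ (s - 1 - d / 2).
Proof. by move=> t0; rewrite [in RHS]powRD//; apply/implyP => _; rewrite gt_eqF. Qed.

(** With s = p / 2, the exponent s - 1 - (p + 1 - alpha) / 2 does not depend on p. *)
Lemma hint_top : exists2 C : R, 0 <= C & forall w, (size w <= p.+1)%N ->
  forall u M t x, CH_bound alpha u M -> 0 < t ->
  `|hint G s w u t x| <= C * M * t `^ (alpha / 2 - 3 / 2).
Proof.
have d0 : 0 <= p.+1%:R - alpha.
  by rewrite subr_ge0 (le_trans (ltW alpha1))// ler1n.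
have [C C0 H] := heat_decay d0 (lexx _).
exists (`|G| * C); first exact: mulr_ge0.
move=> w sw u M t x uM t0; rewrite /hint !normrM (ger0_norm (powR_ge0 _ _)).
have -> : alpha / 2 - 3 / 2 = s - 1 - (p.+1%:R - alpha) / 2.
  by rewrite /s -natr1; field.
rewrite -powR_time//.
have -> : `|G| * C * M * (t `^ (s - 1) * t `^ (- ((p.+1%:R - alpha) / 2))) =
  `|G| * (t `^ (s - 1) * (C * M * t `^ (- ((p.+1%:R - alpha) / 2)))) by ring.
by rewrite ler_wpM2l// ler_wpM2l ?powR_ge0// H.
Qed.

(** Words of length at most p satisfy the decay for p as well as the one for p + 1; the smaller of
    the two, with d = 1, is integrable on the half-line. *)
Lemma hint_hmaj : exists2 C : R, 0 <= C & forall w, (size w <= p)%N ->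
  forall u M t x, CH_bound alpha u M -> 0 < t ->
  `|hint G s w u t x| <= C * M * hmaj (alpha / 2) 1 t.
Proof.
have d0 : 0 <= p%:R - alpha.
  by rewrite subr_ge0 (le_trans (ltW alpha1))// ler1n.
have [C1 C10 H1] := heat_decay d0 (lexx _); have [C2 C20 H2] := hint_top.
exists (`|G| * C1 + C2); first by rewrite addr_ge0// mulr_ge0.
move=> w sw u M t x uM t0; have M0 := CHb_ge0 alpha0 uM.
rewrite /hmaj minr_pMr; last by rewrite mulr_ge0// addr_ge0// mulr_ge0.
rewrite le_min mul1r; apply/andP; split.
  apply: (@le_trans _ _ (`|G| * C1 * M * t `^ (alpha / 2 - 1))); last first.
    by rewrite ler_wpM2r ?powR_ge0// ler_wpM2r// lerDl.
  rewrite /hint !normrM (ger0_norm (powR_ge0 _ _)).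
  have -> : alpha / 2 - 1 = s - 1 - (p%:R - alpha) / 2 by rewrite /s; field.
  rewrite -powR_time//.
  have -> : `|G| * C1 * M * (t `^ (s - 1) * t `^ (- ((p%:R - alpha) / 2))) =
    `|G| * (t `^ (s - 1) * (C1 * M * t `^ (- ((p%:R - alpha) / 2)))) by ring.
  by rewrite ler_wpM2l// ler_wpM2l ?powR_ge0// H1.
apply: (@le_trans _ _ (C2 * M * t `^ (alpha / 2 - 3 / 2))).
  by apply: H2 => //; exact: leqW.
by rewrite ler_wpM2r ?powR_ge0// ler_wpM2r// lerDr mulr_ge0.
Qed.

Lemma measurable_hint_joint d (T : measurableType d) w u M (t : T -> R) (x : T -> 'rV[R]_n) :
  CH_bound alpha u M -> measurable_fun setT t ->
  (forall k, measurable_fun setT (fun q => x q 0 k)) ->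
  measurable_fun setT (fun q => hint G s w u (t q) (x q)).
Proof.
move=> uM mt mx; apply: measurable_funM => //; apply: measurable_funM.
  by apply: (@measurableT_comp _ _ _ _ _ _ ((@powR R)^~ (s - 1))).
apply: (measurable_kint_joint (CHb_meas uM) w).
- by apply: (@measurableT_comp _ _ _ _ _ _ (@rt R)) => //; exact: measurable_rt.
- by apply: (@measurableT_comp _ _ _ _ _ _ (@ct R)) => //; exact: measurable_ct.
- exact: mx.
- by move=> q; exact: rt_ge0.
Qed.

Lemma hint_mul w u M t x k : CH_bound alpha u M -> 0 < t ->
  x 0 k * hint G s w u t x =
  (hint G s ((false, k) :: w) u t x + hint G s ((true, k) :: w) u t x) / 2.
Proof.
move=> uM t0; have := kint_mul (CHb_meas uM) (CHb_sup alpha0 uM) w x k (rt01 t0) (ct01 t).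
rewrite /hint /heat => h.
rewrite mulrCA [x 0 k * _]mulrCA h; by field.
Qed.

Lemma is_derive_hint w u M t x k (y : R) : CH_bound alpha u M -> 0 < t ->
  is_derive y 1 (fun y : R => hint G s w u t (upd x k y))
  ((hint G s ((false, k) :: w) u t (upd x k y) -
    hint G s ((true, k) :: w) u t (upd x k y)) / 2).
Proof.
move=> uM t0; have h := is_derive_kint (CHb_meas uM) (CHb_sup alpha0 uM) w x k y (rt01 t0) (ct01 t).
have h2 := is_derive_scale G (is_derive_scale (t `^ (s - 1)) h).
by apply: is_derive_ext h2 => //; rewrite /hint /heat; field.
Qed.

Lemma htrans_CH : exists2 C : R, 0 <= C & forall w, (size w <= p)%N ->
  forall u M, CH_bound alpha u M ->
  CH alpha (htrans G s w u) /\ (CH_norm alpha (htrans G s w u) <= (C * M)%:E)%E.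
Proof.
have [C1 C10 H1] := hint_hmaj; have [C2 C20 H2] := hint_top.
have K0 : 0 <= tconst n alpha.
  rewrite /tconst mulr_ge0// addr_ge0// invr_ge0 ?divr_ge0 ?(ltW alpha0)//.
  by rewrite subr_ge0 ler_pM2r ?invr_gt0// ltW.
exists (2 * (tconst n alpha * (C1 + C2))).
  by apply: mulr_ge0 => //; apply: mulr_ge0 => //; exact: addr_ge0.
move=> w sw u M uM; have M0 := CHb_ge0 alpha0 uM.
have -> : 2 * (tconst n alpha * (C1 + C2)) * M = 2 * (tconst n alpha * ((C1 + C2) * M)) by ring.
have top t x k b : 0 < t -> `|hint G s ((b, k) :: w) u t x| <= (C1 + C2) * M * t `^ (alpha / 2 - 3 / 2).
  move=> t0; apply: (@le_trans _ _ (C2 * M * t `^ (alpha / 2 - 3 / 2))).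
    by apply: H2.
  by rewrite ler_wpM2r ?powR_ge0// ler_wpM2r// lerDr.
apply: (@CH_time_integral R n alpha alpha0 alpha1 (hint G s w u)).
- by rewrite mulr_ge0// addr_ge0.
- by move=> x; apply: (measurable_hint_joint w uM (t := id) (x := fun=> x)).
- move=> t x t0; apply: le_trans (H1 _ sw _ _ _ x uM t0) _.
  by rewrite ler_wpM2r ?hmaj_ge0// ler_wpM2r// lerDl.
- move=> t x k t0; rewrite (hint_mul w x k uM t0) normrM (@ger0_norm _ 2^-1)//.
  rewrite ler_pdivrMr//; apply: le_trans (ler_normD _ _) _.
  by rewrite mulr_natr mulr2n; apply: lerD; exact: top.
- move=> t x k y t0.
  rewrite -[X in _ - hint _ _ _ _ _ X](upd_id x k).
  apply: (@le_norm_MVT R (fun z => hint G s w u t (upd x k z)) _ _ (x 0 k) y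
    (fun z => is_derive_hint w x k z uM t0)) => z.
  rewrite normrM (@ger0_norm _ 2^-1)// ler_pdivrMr//; apply: le_trans (ler_normB _ _) _.
  by rewrite mulr_natr mulr2n; apply: lerD; exact: top.
Qed.

Lemma integrable_mul_fast (f psi : 'rV[R]_n -> R) (K : R) :
  measurable_fun setT (f \o @tuple_rV R n) -> (forall x, `|f x| <= K) ->
  measurable_fun setT (psi \o @tuple_rV R n) -> fast psi ->
  L.-integrable setT (EFin \o (fun t => f (tuple_rV t) * psi (tuple_rV t))).
Proof.
move=> mf fK mpsi [K' HK'].
apply: (integrable_dom measurableT (measurable_funM mf mpsi)
  (integrableZl measurableT (K * K') integrable_prod_cauchy)) => t _ /=.
rewrite normrM -mulrA; apply: ler_pM => //.
Qed.

Lemma kint_fast_integrable w u M t psi : CH_bound alpha u M -> 0 < t ->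
  measurable_fun setT (psi \o @tuple_rV R n) -> fast psi ->
  L.-integrable setT (EFin \o (fun z => heat w u t (tuple_rV z) * psi (tuple_rV z))).
Proof.
move=> uM t0 mpsi fpsi; have [C C0 H] := @kint_bound0 R n w.
have mk := measurable_kint (CHb_meas uM) (ct t) w (rt_ge0 t).
apply: (integrable_mul_fast mk _ mpsi fpsi) => x.
exact: (H _ _ u M x (CHb_meas uM) (CHb_sup alpha0 uM) (rt01 t0) (ct01 t)).
Qed.

(** Fubini with a majorant that separates the variables: [hmaj] in time, a product of [cauchy_fun]
    in space. *)
Lemma htrans_pairing w u M psi : (size w <= p)%N -> CH_bound alpha u M ->
  measurable_fun setT (psi \o @tuple_rV R n) -> fast psi ->
  leb.-integrable D (EFin \o (fun t => integral_rV (fun x => hint G s w u t x * psi x))) /\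
  integral_rV (fun x => htrans G s w u x * psi x) =
  \int[leb]_(t in D) integral_rV (fun x => hint G s w u t x * psi x).
Proof.
move=> sw uM mpsi [K HK]; have [C C0 H] := hint_hmaj.
have a0 : 0 < alpha / 2 by rewrite divr_gt0.
have a1 : alpha / 2 < 1 / 2 by rewrite ltr_pM2r// invr_gt0.
have M0 := CHb_ge0 alpha0 uM.
have mD : measurable D by exact: measurable_itv.
pose g (t : mR) : R := C * M * hmaj (alpha / 2) 1 t.
have ig : leb.-integrable D (EFin \o g).
  exact: (integrableZl mD _ (integrable_hmaj a0 a1 ltr01)).
pose h (z : n.-tuple mR) : R := K * \prod_k cauchy_fun (tuple_rV z 0 k).
have ih : L.-integrable setT (EFin \o h).
  exact: (integrableZl measurableT K integrable_prod_cauchy).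
have mf : measurable_fun setT (fun q : mR * n.-tuple mR =>
    hint G s w u q.1 (tuple_rV q.2) * psi (tuple_rV q.2)).
  apply: measurable_funM; last by apply: (measurableT_comp mpsi).
  apply: (measurable_hint_joint w uM) => // k.
  under eq_fun do rewrite tuple_rVE.
  by apply: (measurableT_comp (measurable_tnth k)).
have fgh (t : mR) z : D t -> `|hint G s w u t (tuple_rV z) * psi (tuple_rV z)| <= g t * h z.
  rewrite /D/= in_itv/= andbT => t0; rewrite normrM; apply: ler_pM => //.
  exact: H.
have [i1 e1] := Rfubini_on mD mf ig ih fgh.
split; first exact: i1.
rewrite -[RHS]e1; apply: eq_Rintegral => z _.
rewrite [RHS](_ : _ = \int[leb]_(t in D) (psi (tuple_rV z) * hint G s w u t (tuple_rV z))).
  rewrite RintegralZl// 1?mulrC//.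
  have mh : measurable_fun D (fun t : mR => hint G s w u t (tuple_rV z)).
    apply: measurable_funTS; exact: (measurable_hint_joint w uM (t := id) (x := fun=> tuple_rV z)).
  apply: (integrable_dom mD mh ig) => t; rewrite /D/= in_itv/= andbT => t0; exact: H.
by apply: eq_Rintegral => t _; rewrite mulrC.
Qed.

(** For fixed t this is integration by parts and multiplication by x_k. The condition on the length
    makes the time integrals of both w and i :: w converge absolutely, so both pairings may be
    computed under the time integral. *)
Lemma htrans_A i w u M phi : (size w < p)%N -> CH_bound alpha u M -> test phi ->
  distr_A i (distr_of_fun (htrans G s w u)) phi =
  distr_of_fun (htrans G s (i :: w) u) phi.
Proof.
case: i => b k sw uM tphi.
have mD : measurable D by exact: measurable_itv.
have mphi := measurable_diff (test_diff tphi).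
have mpphi := continuous_measurable_rV (@test_cont _ _ _ tphi k).
have mxphi : measurable_fun setT ((fun x => x 0 k * phi x) \o @tuple_rV R n).
  apply: measurable_diff; apply: differentiable_mulX; exact: test_diff.
have [i1 e1] := htrans_pairing (ltnW sw) uM mpphi (test_fast_partial tphi k).
have [i2 e2] := htrans_pairing (ltnW sw) uM mxphi (test_fast_mulX tphi k).
have [_ e3] := htrans_pairing (w := (b, k) :: w) sw uM mphi (test_fast tphi).
rewrite /distr_A /distr_partial /distr_mulX /distr_of_fun/= e1 e2 e3.
apply: (Rintegral_lin mD i1 i2) => t; rewrite /D/= in_itv/= andbT => t0.
pose J i := integral_rV (fun x => heat (i :: w) u t x * phi x).
have iJ i := kint_fast_integrable (i :: w) uM t0 mphi (test_fast tphi).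
have pull v psi : measurable_fun setT (psi \o @tuple_rV R n) -> fast psi ->
    integral_rV (fun x => hint G s v u t x * psi x) =
    G * t `^ (s - 1) * integral_rV (fun x => heat v u t x * psi x).
  move=> m f; rewrite /integral_rV -RintegralZl//.
    by apply: eq_Rintegral => z _; rewrite /hint !mulrA.
  exact: (kint_fast_integrable v uM t0).
rewrite (pull _ _ mphi (test_fast tphi)) (pull _ _ mxphi (test_fast_mulX tphi k)).
rewrite (pull _ _ mpphi (test_fast_partial tphi k)).
have E1 : - integral_rV (fun x => heat w u t x * partial k phi x) =
    (J (false, k) - J (true, k)) / 2.
  rewrite (kint_ibp (CHb_meas uM) (CHb_sup alpha0 uM) w k (rt01 t0) (ct01 t) tphi).
  rewrite /J /integral_rV -RintegralB// -RintegralZr//; last first.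
    by have := integrableB measurableT (iJ (false, k)) (iJ (true, k)); apply: eq_integrable.
  by apply: eq_Rintegral => z _; rewrite /heat; field.
have E2 : integral_rV (fun x => heat w u t x * (x 0 k * phi x)) =
    (J (false, k) + J (true, k)) / 2.
  rewrite /J /integral_rV -RintegralD// -RintegralZr//; last first.
    by have := integrableD measurableT (iJ (false, k)) (iJ (true, k)); apply: eq_integrable.
  apply: eq_Rintegral => z _; rewrite mulrCA mulrA.
  rewrite (kint_mul (CHb_meas uM) (CHb_sup alpha0 uM) w (tuple_rV z) k (rt01 t0) (ct01 t)).
  by rewrite /heat; field.
rewrite E2 -mulrN E1 -[integral_rV (fun x => heat ((b, k) :: w) u t x * phi x)]/(J (b, k)).
exact: (sign_split b _ (fun b => J (b, k))).
Qed.

End order.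

End transform.

Lemma H_negpow_htrans (R : realType) n (alpha : R) (p : nat) (u : 'rV[R]_n -> R) M :
  (0 < n)%N -> 0 < alpha -> alpha < 1 -> (0 < p)%N -> CH_bound alpha u M ->
  H_negpow (p%:R / 2) u = htrans (Gamma (p%:R / 2))^-1 (p%:R / 2) [::] u.
Proof.
move=> n0 alpha0 alpha1 p0 uM; apply/funext => x; rewrite /H_negpow /htrans.
set s := p%:R / 2; have mD : measurable (`]0%R, +oo[%classic : set (measurableTypeR R)).
  exact: measurable_itv.
have [C C0 H] := @hint_hmaj R n alpha alpha0 alpha1 n0 1 p p0.
have a0 : 0 < alpha / 2 by rewrite divr_gt0.
have a1 : alpha / 2 < 1 / 2 by rewrite ltr_pM2r// invr_gt0.
have mh : measurable_fun (`]0%R, +oo[%classic : set (measurableTypeR R)) (hint 1 s [::] u ^~ x).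
  apply: measurable_funTS.
  exact: (measurable_hint_joint 1 p [::] uM (t := id) (x := fun=> x)).
have ih : (@lebesgue_measure R).-integrable `]0%R, +oo[ (EFin \o (hint 1 s [::] u ^~ x)).
  apply: (integrable_dom mD mh (integrableZl mD (C * M) (integrable_hmaj a0 a1 ltr01))) => t.
  by rewrite /= in_itv/= andbT => t0; exact: H.
(* The factor 1 / Gamma enters the integral by linearity, which rests on the integrability [ih];
   hence the intermediate form with constant 1. *)
transitivity ((Gamma s)^-1 * \int[@lebesgue_measure R]_(t in `]0%R, +oo[) hint 1 s [::] u t x).
  congr (_ * _); apply: eq_Rintegral => t; rewrite inE/= in_itv/= andbT => t0.
  rewrite /hint mul1r mulrC /heat /heat_semigroup /kint; congr (_ * _).
    by rewrite -powRN opprB.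
  by congr integral_rV; apply/funext => z; rewrite mehler_kern.
rewrite -RintegralZl//; apply: eq_Rintegral => t _.
by rewrite /hint mul1r.
Qed.

Theorem theorem4p1 (R : realType) (n : nat) (alpha : R) :
  (1 <= n)%N -> 0 < alpha -> alpha < 1 ->
  exists C : R, forall (i j : hindex n) (u : 'rV[R]_n -> R),
    CH alpha u ->
    exists v w : 'rV[R]_n -> R,
      [/\ CH alpha v, distr_coincides (riesz1 i u) v,
          CH alpha w, distr_coincides (riesz2 i j u) w &
          (CH_norm alpha v + CH_norm alpha w <= C%:E * CH_norm alpha u)%E].
Proof.
move=> n0 alpha0 alpha1.
pose v i u := htrans (Gamma (1%:R / 2))^-1 (1%:R / 2 : R) [:: i] u : 'rV[R]_n -> R.
pose w i j u := htrans (Gamma (2%:R / 2))^-1 (2%:R / 2 : R) [:: i; j] u : 'rV[R]_n -> R.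
have [C1 _ H1] := htrans_CH alpha0 alpha1 n0 (Gamma (1%:R / 2))^-1 (ltn0Sn 0).
have [C2 _ H2] := htrans_CH alpha0 alpha1 n0 (Gamma (2%:R / 2))^-1 (ltn0Sn 1).
exists (C1 + C2) => i j u uCH; exists (v i u), (w i j u).
have [uM uE] := CH_boundP n0 uCH.
set M := fine _ in uM uE.
have [v1 v2] := H1 [:: i] (leqnn _) u M uM; have [w1 w2] := H2 [:: i; j] (leqnn _) u M uM.
have h1 : H_negpow 2^-1 u = htrans (Gamma (1%:R / 2))^-1 (1%:R / 2) [::] u.
  by rewrite -(H_negpow_htrans n0 alpha0 alpha1 (ltn0Sn 0) uM) div1r.
have h2 : H_negpow 1 u = htrans (Gamma (2%:R / 2))^-1 (2%:R / 2) [::] u.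
  by rewrite -(H_negpow_htrans n0 alpha0 alpha1 (ltn0Sn 1) uM) divff.
split; [exact: v1| |exact: w1| |].
- move=> phi sphi; rewrite /riesz1 h1.
  exact: (htrans_A alpha0 alpha1 n0 _ (ltn0Sn 0) i (w := [::]) (ltn0Sn 0) uM (schwartz_test_iter [::] sphi)).
- move=> phi sphi; rewrite /riesz2 h2.
  (* The outer operator A_i falls on the test function, so the identity for A_j is needed at x_k phi
     and at the k-th partial derivative of phi, k being the index of i. *)
  have step psi : test psi ->
      distr_A j (distr_of_fun (htrans (Gamma (2%:R / 2))^-1 (2%:R / 2) [::] u)) psi =
      distr_of_fun (htrans (Gamma (2%:R / 2))^-1 (2%:R / 2) [:: j] u) psi.
    exact: (htrans_A alpha0 alpha1 n0 _ (ltn0Sn 1) j (w := [::]) (ltn0Sn 1) uM).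
  have e := htrans_A alpha0 alpha1 n0 (Gamma (2%:R / 2))^-1 (ltn0Sn 1) i (w := [:: j]) (ltnSn 1) uM
    (schwartz_test_iter [::] sphi).
  rewrite -e {1}/distr_A {1}/distr_partial {1}/distr_mulX !step//.
    exact: schwartz_test_mulX.
  exact: (schwartz_test_iter [:: i.2] sphi).
- by rewrite uE -EFinM mulrDl EFinD leeD.
Qed.
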